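(* For every $\varepsilon,\alpha>0$ there exists $n_0=n_0(\varepsilon,\alpha)$ such that the following holds for every standard multigraph $M=(V,E)$ on $n\ge n_0$ vertices with $n$ divisible by $3$: if $\delta(M)\geq\left(\frac43+\varepsilon\right)n$ and $H_M$ is not $\alpha$-splittable, then $M$ has a $5$-triangle factor.
   Context: Multigraphs have no loops; $\mu(x,y)$ is the number of edges with ends $x,y$. $M$ is standard if $\mu(x,y)\le2$ for all $x,y$. The degree of $x$ is $d(x)=\sum_y\mu(x,y)$ and $\delta(M)=\min_x d(x)$. $H_M$ is the simple graph on $V$ whose edges are the pairs $xy$ with $\mu(x,y)=2$. A simple graph $G$ on $n$ vertices is $\alpha$-splittable if there is a partition $\{A,B\}$ of $V(G)$ with $|A|,|B|\ge\frac n3$ and the number of edges of $G$ with one end in $A$ and the other in $B$ at most $\alpha n^2$. A $5$-triangle is a multigraph on three vertices containing a triangle $C_3$ and having exactly $5$ edges counted with multiplicity. A $5$-triangle factor of $M$ is a set of pairwise vertex-disjoint sub-multigraphs of $M$, each a $5$-triangle, whose vertex sets cover $V$ (equivalently, a partition of $V$ into triples $\{x,y,z\}$ that are pairwise adjacent with $\mu(x,y)+\mu(y,z)+\mu(x,z)\ge5$). *)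

(* Defs.v *)
From HB Require Import structures.
From mathcomp Require Import all_boot all_order all_algebra.
From mathcomp Require Import reals.
Set Implicit Arguments. Unset Strict Implicit. Unset Printing Implicit Defensive.
Import Order.TTheory GRing.Theory Num.Theory.

(* Parallel edges are unlabelled, so a multigraph is its multiplicity function. *)
Record multigraph (V : finType) := Multigraph {
  mult : V -> V -> nat;
  mult_sym : forall x y, mult x y = mult y x;
  mult_loopless : forall x, mult x x = 0 }.

Definition standard (V : finType) (M : multigraph V) : Prop :=
  forall x y : V, mult M x y <= 2.

Definition degree (V : finType) (M : multigraph V) (x : V) : nat :=
  \sum_(y : V) mult M x y.

(* The value 0 on an empty vertex set is a junk value. *)
Definition min_degree (V : finType) (M : multigraph V) : nat :=
  if [pick x0 : V] is Some x0 then degree M [arg min_(x < x0) degree M x] else 0.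

(* The degree sum counts each edge twice, once for each of its ends. *)
Definition num_edges (V : finType) (M : multigraph V) : nat :=
  (\sum_(x : V) degree M x)./2.

Record simple_graph (V : finType) := SimpleGraph {
  adj : rel V;
  adj_sym : symmetric adj;
  adj_irr : irreflexive adj }.

Section DoubleEdgeGraph.
Variables (V : finType) (M : multigraph V).

Definition double_adj : rel V := fun x y => mult M x y == 2.

Fact double_adj_sym : symmetric double_adj.
Proof. by move=> x y; rewrite /double_adj mult_sym. Qed.

Fact double_adj_irr : irreflexive double_adj.
Proof. by move=> x; rewrite /double_adj mult_loopless. Qed.

Definition double_graph : simple_graph V :=
  SimpleGraph double_adj_sym double_adj_irr.
End DoubleEdgeGraph.

(* Only used for disjoint A and B, where each edge with one end in A and the
   other in B is counted exactly once, oriented from A to B. *)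
Definition edges_between (V : finType) (G : simple_graph V) (A B : {set V}) : nat :=
  #|[set p in setX A B | adj G p.1 p.2]|.

Definition splittable (R : realType) (V : finType) (alpha : R)
    (G : simple_graph V) : Prop :=
  exists A B : {set V},
    [/\ A :|: B = [set: V], [disjoint A & B],
        (#|V|%:R / 3 <= #|A|%:R :> R)%R,
        (#|V|%:R / 3 <= #|B|%:R :> R)%R &
        ((edges_between G A B)%:R <= alpha * #|V|%:R ^+ 2)%R].

Definition five_triangle (V : finType) (T : multigraph V) : bool :=
  [&& #|V| == 3, [forall x, forall y, (x != y) ==> (0 < mult T x y)]
    & num_edges T == 5].

(* Not necessarily induced: both vertices and edges of M may be deleted. *)
Record sub_multigraph (V : finType) (M : multigraph V) := SubMultigraph {
  sub_verts : {set V};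
  sub_graph :> multigraph {x : V | x \in sub_verts};
  sub_mult_le : forall x y, mult sub_graph x y <= mult M (val x) (val y) }.

(* A sequence represents the set of its members: 5-triangles have nonempty
   vertex sets, so pairwise disjointness rules out repetitions. *)
Definition has_five_triangle_factor (V : finType) (M : multigraph V) : Prop :=
  exists F : seq (sub_multigraph M),
    [/\ all (fun T : sub_multigraph M => five_triangle T) F,
        pairwise (fun T1 T2 => [disjoint sub_verts T1 & sub_verts T2]) F &
        \bigcup_(T <- F) sub_verts T = [set: V]].

(* Main.v *)
Require Import Defs.
From HB Require Import structures.
From mathcomp Require Import all_boot all_order all_algebra.
From mathcomp Require Import reals boolp zify ring lra.
Import Order.TTheory GRing.Theory Num.Theory.
Local Open Scope ring_scope.
Set Implicit Arguments. Unset Strict Implicit. Unset Printing Implicit Defensive.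

(** The proof is by absorption, without regularity or randomness.

    Near-tiling: take a maximum family of disjoint 5-triangles leaving a set L, and then a maximum matching of double
    edges in L.  Two matching edges each sending at least 9 edges to the same tile give a larger family, and two other
    vertices of L each sending at least 5 edges to a common tile through the same vertex give a larger matching; as
    the degree condition forces an average above 4 edges from a vertex to a tile, L has bounded size.

    Reachability: x reaches y if for a positive proportion of the k-tuples s both s + x and s + y can be tiled.  A
    double edge forms a 5-triangle with more than n/3 vertices, so among any three double edges two have many common
    apexes.  Hence either all pairs of vertices reach each other, or V splits into two classes A and B of size at
    least n/3 inside which this holds.  Since the double edge graph is not splittable, there are many 5-triangles of
    type AAB, say.  If there are also many of type AAA or ABB, then A and B reach each other.  Otherwise, for a typical
    a in A the double neighbourhoods of a in A and in B are both almost independent, hence smaller than n/3, hence both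
    large; adding degrees along double edges then gives |B| < n/3.

    Absorption: since every triple of vertices is absorbed by a positive proportion of the tuples, greedy averaging
    finds few disjoint tuples that between them absorb any single triple; boundedly many such families suffice to
    absorb L. *)

(** * Tileable sequences and sequential counting *)

Section Tileable.
Variables (V : finType) (M : multigraph V).
Notation mu := (mult M).

(** Positivity makes the three vertices distinct, as there are no loops; in a standard multigraph
    the last inequality leaves at most one of the three pairs simple. *)
Definition tri (x y z : V) : bool :=
  [&& 0 < mu x y, 0 < mu y z, 0 < mu x z & 5 <= mu x y + mu y z + mu x z]%N.

Lemma tri_rot x y z : tri x y z = tri y z x.
Proof.
by rewrite /tri (mult_sym M y x) (mult_sym M z x); apply/idP/idP; lia.
Qed.

Lemma tri_swap x y z : tri x y z = tri x z y.
Proof.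
by rewrite /tri (mult_sym M z y); apply/idP/idP; lia.
Qed.

Definition flat3 (ts : seq (V * V * V)) : seq V :=
  flatten [seq [:: t.1.1; t.1.2; t.2] | t <- ts].

Definition flat2 (ms : seq (V * V)) : seq V := flatten [seq [:: p.1; p.2] | p <- ms].

Definition tri3 (t : V * V * V) := tri t.1.1 t.1.2 t.2.

(** [s] may repeat vertices; distinctness is imposed separately where it matters, so tileability is
    closed under plain concatenation. *)
Definition tileable (s : seq V) :=
  exists2 ts : seq (V * V * V), all tri3 ts & perm_eq (flat3 ts) s.

Lemma tileable_perm s s' : perm_eq s s' -> tileable s -> tileable s'.
Proof. by move=> ss' [ts ht hp]; exists ts => //; apply: perm_trans hp ss'. Qed.

Lemma tileable_nil : tileable [::].
Proof. by exists [::]. Qed.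

Lemma tileable_cat s s' : tileable s -> tileable s' -> tileable (s ++ s').
Proof.
move=> [ts ht hp] [ts' ht' hp']; exists (ts ++ ts'); first by rewrite all_cat ht ht'.
by rewrite /flat3 map_cat flatten_cat; apply: perm_cat.
Qed.

Lemma tileable_tri x y z : tri x y z -> tileable [:: x; y; z].
Proof. by move=> h; exists [:: (x, y, z)]; rewrite /= ?andbT. Qed.

Lemma tileable_size s : tileable s -> (3 %| size s)%N.
Proof.
by move=> [ts _ /perm_size <-]; elim: ts.
Qed.

End Tileable.

Lemma perm_solver (T : eqType) (s s' : seq T) :
  (forall a : pred T, count a s = count a s') -> perm_eq s s'.
Proof. by move/permP. Qed.

(** Equality of counts for an arbitrary predicate becomes linear arithmetic once each truth value is
    generalized to a natural number. *)
Ltac count_lia :=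
  clear; rewrite /flat3 /flat2 /=; repeat rewrite count_cat /=;
  repeat match goal with |- context [nat_of_bool ?b] => generalize (nat_of_bool b); intro end;
  lia.

Ltac perm_tac := apply: perm_solver => ?; count_lia.

(** * Counting tuples one entry at a time *)

Section Many.
Variables (R : realType) (V : finType).
Notation n := (#|V|%:R : R).
Implicit Types (c : R) (P Q : seq V -> Prop).

(* Implies that a proportion [c ^+ k] of the [k]-tuples satisfies [P], but composes better and survives forbidding a
   few vertices at each step. *)
Fixpoint many c (k : nat) P : Prop :=
  if k is k'.+1 then
    c * n <= #|[set z | `[< many c k' (fun s => P (z :: s)) >]]|%:R
  else P [::].

Lemma many_mono c c' k P Q :
  c' <= c -> (forall s, P s -> Q s) -> many c k P -> many c' k Q.
Proof.
move=> cc'; elim: k P Q => [|k IH] P Q PQ /=; first exact: PQ.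
move=> h; apply: (@le_trans _ _ (c * n)); first by rewrite ler_wpM2r.
apply: (le_trans h); rewrite ler_nat; apply: subset_leq_card.
apply/fintype.subsetP => z; rewrite !inE => /asboolP hz; apply/asboolP.
by apply: IH hz => s; apply: PQ.
Qed.

(** No constant is lost, since [c] bounds each single choice rather than the number of tuples. *)
Lemma many_cat c k k' P Q :
  (forall s, P s -> many c k' (fun s' => Q (s ++ s'))) ->
  many c k P -> many c (k + k') Q.
Proof.
elim: k P Q => [|k IH] P Q PQ /=; first exact: PQ.
move=> h; apply: (le_trans h); rewrite ler_nat; apply: subset_leq_card.
apply/fintype.subsetP => z; rewrite !inE => /asboolP hz; apply/asboolP.
by apply: IH hz => s; apply: PQ.
Qed.

Lemma many_le1 c (A : {set V}) P :
  c * n <= #|A|%:R -> (forall z, z \in A -> P [:: z]) -> many c 1 P.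
Proof.
move=> h hP /=; apply: (le_trans h); rewrite ler_nat; apply: subset_leq_card.
by apply/fintype.subsetP => z hz; rewrite inE; apply/asboolP; apply: hP.
Qed.

(** At every step at most [size W + k] vertices are forbidden, which costs at most half of the
    [c * n] admissible choices. *)
Lemma many_fresh c k P (W : seq V) :
  uniq W -> (size W + k)%:R <= c / 2 * n -> many c k P ->
  many (c / 2) k (fun s => P s /\ uniq (s ++ W)).
Proof.
elim: k P W => [|k IH] P W uW hW /=; first by [].
move=> h.
have hsub : [set z | `[< many c k (fun s => P (z :: s)) >]] \subset
   [set z | `[< many (c/2) k (fun s => P (z :: s) /\ uniq ((z :: s) ++ W)) >]]
   :|: [set z in W].
  apply/fintype.subsetP => z; rewrite !inE => /asboolP hz.
  have [zW|zW] := boolP (z \in W); rewrite ?orbT // orbF; apply/asboolP.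
  have := IH (fun s => P (z :: s)) (z :: W); rewrite /= zW uW addSnnS => /(_ isT hW hz); apply: many_mono => // s [h1 h2]; split => //.
  by move: h2; rewrite -cat1s uniq_catCA.
have := subset_leq_card hsub; rewrite -(ler_nat R) => h1.
have h2 := le_trans h h1.
have h4 : (#|[set z | `[< many (c / 2) k (fun s => P (z :: s) /\ uniq ((z :: s) ++ W)) >]]
   :|: [set z in W]|%:R : R) <= 
   #|[set z | `[< many (c / 2) k (fun s => P (z :: s) /\ uniq ((z :: s) ++ W)) >]]|%:R + (size W)%:R.
  rewrite -natrD ler_nat; apply: leq_trans (leq_card_setU _ _) _.
  by rewrite leq_add2l cardsE card_size.
have h5 : (size W)%:R <= c / 2 * n by apply: le_trans hW; rewrite ler_nat; lia.
lra.
Qed.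

(** Double counting of the related pairs: some [z] does at least as well as the average. *)
Lemma exists_popular (T : finType) (S : finType) (Om : {set T}) (c : R) (rl : T -> S -> bool) :
  (0 < #|S|)%N -> (forall t, t \in Om -> c * #|S|%:R <= #|[set z | rl t z]|%:R) ->
  exists z, c * #|Om|%:R <= #|[set t in Om | rl t z]|%:R.
Proof.
move=> S0 h; apply: contrapT => hn.
have hz z : #|[set t in Om | rl t z]|%:R < c * #|Om|%:R.
  by rewrite ltNge; apply/negP => hh; apply: hn; exists z.
have e : (\sum_(t in Om) #|[set z | rl t z]| = \sum_(z : S) #|[set t in Om | rl t z]|)%N.
  under eq_bigr => t _ do rewrite -sum1_card.
  under [RHS]eq_bigr => z _ do rewrite -sum1_card.
  under eq_bigr => t _ do (under eq_bigl => z do rewrite inE).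
  under [RHS]eq_bigr => z _ do (under eq_bigl => t do rewrite inE).
  by rewrite (exchange_big_dep predT) //=.
have h1 : c * #|S|%:R * #|Om|%:R <= (\sum_(t in Om) #|[set z | rl t z]|)%N%:R.
  rewrite natr_sum mulrC mulr_natl -sumr_const; apply: ler_sum => t; exact: h.
have h2 : (\sum_(z : S) #|[set t in Om | rl t z]|)%N%:R < c * #|Om|%:R * #|S|%:R.
  rewrite natr_sum [X in _ < X]mulrC mulr_natl -sumr_const.
  have /card_gt0P[z0 _] := S0.
  by rewrite (bigD1 z0) //= [X in _ < X](bigD1 z0) //= ltr_leD // ler_sum // => z _; apply: ltW.
by move: h1; rewrite e; lra.
Qed.

(** One tuple serving many [t] at once is built entry by entry: each entry is popular among the [t]
    still served, and keeps a proportion [c] of them. *)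
Lemma many_pick (T : finType) c k (P : T -> seq V -> Prop) (Om : {set T}) :
  (0 < #|V|)%N -> 0 <= c -> (forall t, t \in Om -> many c k (P t)) ->
  exists2 s, size s = k & c ^+ k * #|Om|%:R <= #|[set t in Om | `[< P t s >]]|%:R.
Proof.
move=> V0 c0; elim: k P Om => [|k IH] P Om h.
  exists [::] => //; rewrite expr0 mul1r ler_nat; apply: subset_leq_card.
  by apply/fintype.subsetP => t tO; rewrite inE tO; apply/asboolP; apply: h.
have [z hz] := exists_popular V0 h.
set Om' := [set t in Om | _] in hz.
have [|s ss hs] := IH (fun t s => P t (z :: s)) Om'.
  by move=> t; rewrite inE => /andP[_ /asboolP].
exists (z :: s); first by rewrite /= ss.
rewrite exprSr -mulrA; apply: le_trans (_ : _ <= c ^+ k * #|Om'|%:R) _.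
  by rewrite ler_wpM2l // exprn_ge0.
apply: (le_trans hs); rewrite ler_nat; apply: subset_leq_card.
by apply/fintype.subsetP => t; rewrite !inE => /andP[/andP[-> _] ->].
Qed.

Lemma card_fibers (S T : finType) (D : {set S * T}) :
  (#|D| = \sum_(z : S) #|[set t | (z, t) \in D]|)%N.
Proof.
rewrite -sum1_card; under [RHS]eq_bigr => z _ do rewrite -sum1_card.
by rewrite pair_big_dep /=; apply: eq_bigl => -[z t]; rewrite inE.
Qed.

(** Sparse fibers contribute at most half of the assumed size of [D], and a dense one at most
    [#|T|], so there are many dense ones. *)
Lemma dense_fibers (T : finType) (D : {set V * T}) c :
  (0 < #|T|)%N -> 0 <= c -> c * n * #|T|%:R <= #|D|%:R ->
  c / 2 * n <= #|[set z | c / 2 * #|T|%:R <= #|[set t | (z, t) \in D]|%:R]|%:R.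
Proof.
move=> T0 c0 h.
have e := card_fibers D.
set G := [set z | _].
have h1 : (#|D|%:R : R) <= \sum_(z : V) (c / 2 * #|T|%:R + (z \in G)%:R * #|T|%:R).
  rewrite e natr_sum; apply: ler_sum => z _.
  have [zG|zG] := boolP (z \in G).
    rewrite mul1r; apply: ler_wpDl; last by rewrite ler_nat max_card.
    by rewrite mulr_ge0 ?ler0n // divr_ge0.
  by move: zG; rewrite mul0r addr0 inE -ltNge => /ltW.
rewrite big_split /= sumr_const -mulr_suml -natr_sum in h1.
have e2 : (\sum_(z : V) (z \in G) = #|G|)%N by rewrite -sum1_card [RHS]big_mkcond.
rewrite e2 -mulr_natr in h1.
have T0' : (0 : R) < #|T|%:R by rewrite ltr0n.
rewrite -(ler_pM2r T0'); lra.
Qed.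

Lemma many_pair (D : {set V * V}) c k P :
  (0 < #|V|)%N -> 0 <= c -> c * n ^+ 2 <= #|D|%:R ->
  (forall a b, (a, b) \in D -> many (c / 2) k (fun s => P [:: a, b & s])) ->
  many (c / 2) k.+2 P.
Proof.
move=> V0 c0 h hD; have := @dense_fibers V D c V0 c0; rewrite -mulrA -expr2 => /(_ h) h1.
apply: (le_trans h1); rewrite ler_nat; apply: subset_leq_card.
apply/fintype.subsetP => z; rewrite !inE => h2; apply/asboolP.
apply: (le_trans h2); rewrite ler_nat; apply: subset_leq_card.
by apply/fintype.subsetP => t; rewrite !inE => h3; apply/asboolP; apply: hD.
Qed.

Lemma many_triple (D : {set V * (V * V)}) c k P :
  (0 < #|V|)%N -> 0 <= c -> c * n ^+ 3 <= #|D|%:R ->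
  (forall x y z, (x, (y, z)) \in D -> many (c / 4) k (fun s => P [:: x, y, z & s])) ->
  many (c / 4) k.+3 P.
Proof.
move=> V0 c0 h hD; have := @dense_fibers _ D c; rewrite card_prod muln_gt0 V0 natrM => /(_ isT c0).
rewrite -mulrA -expr2 -exprS => /(_ h) h1.
have c4 : c / 4 = c / 2 / 2 by lra.
apply: (@le_trans _ _ (c / 2 * n)); first by rewrite ler_wpM2r //; lra.
apply: (le_trans h1); rewrite ler_nat; apply: subset_leq_card.
apply/fintype.subsetP => x; rewrite !inE => h2; apply/asboolP.
rewrite c4; have {h2} h2 : c / 2 * n ^+ 2 <= #|[set t | (x, t) \in D]|%:R.
  by move: h2; rewrite ?natrM ?expr2.
have c20 : 0 <= c/2 by rewrite divr_ge0.
change (many (c / 2 / 2) k.+2 (fun s => P (x :: s))).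
apply: (many_pair V0 c20 h2).
by move=> y z; rewrite inE -c4; apply: hD.
Qed.

End Many.
Arguments many : simpl never.

(** * Near-tilings *)

(** The two offending entries are handed over at the front of a reordering of [l], the form in which
    an exchange argument removes them. *)
Lemma count_le1 (T : eqType) (P : pred T) (l : seq T) :
  (forall x x' l', perm_eq l [:: x, x' & l'] -> P x -> P x' -> False) ->
  (count P l <= 1)%N.
Proof.
move=> h; rewrite -size_filter leqNgt; apply/negP => hs.
case e : (filter P l) hs => [|x [|x' f]] // _.
apply: (h x x' (f ++ filter (predC P) l)).
- by rewrite -!cat_cons -e perm_sym; apply/permPl/perm_filterC.
- by have : x \in filter P l; [rewrite e mem_head | rewrite mem_filter => /andP[]].
- by have : x' \in filter P l; [rewrite e !inE eqxx orbT | rewrite mem_filter => /andP[]].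
Qed.

Lemma sum_le_const (T : eqType) (s : seq T) (F : T -> nat) c :
  (forall x, x \in s -> F x <= c)%N -> (\sum_(x <- s) F x <= size s * c)%N.
Proof.
elim: s => [|x s IH] h; first by rewrite big_nil.
rewrite big_cons mulSn leq_add ?h ?mem_head // IH // => y ys.
by apply: h; rewrite inE ys orbT.
Qed.

Lemma sum_ge_const (R : realType) (T : eqType) (s : seq T) (F : T -> R) c :
  (forall x, x \in s -> c <= F x) -> (size s)%:R * c <= \sum_(x <- s) F x.
Proof.
elim: s => [|x s IH] h; first by rewrite big_nil mul0r.
rewrite big_cons -natr1 mulrDl mul1r addrC lerD ?h ?mem_head // IH // => y ys.
by apply: h; rewrite inE ys orbT.
Qed.

Section NearTiling.
Variables (V : finType) (M : multigraph V).
Hypothesis hM : standard M.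
Notation mu := (mult M).
Notation tri := (tri M).
Notation tri3 := (tri3 M).

Definition double (p : V * V) := double_adj M p.1 p.2.

Definition wt (x : V) (t : V * V * V) := (mu x t.1.1 + mu x t.1.2 + mu x t.2)%N.

Lemma wt_le6 x t : (wt x t <= 6)%N.
Proof. by rewrite /wt; move: (hM x t.1.1) (hM x t.1.2) (hM x t.2); lia. Qed.

Lemma sum_flat3 x (ts : seq (V * V * V)) : (\sum_(y <- flat3 ts) mu x y = \sum_(t <- ts) wt x t)%N.
Proof.
elim: ts => [|t ts IH]; first by rewrite !big_nil.
by rewrite /flat3 /= !big_cons IH /wt; lia.
Qed.

Lemma size_flat3 (ts : seq (V * V * V)) : size (flat3 ts) = (3 * size ts)%N.
Proof. by elim: ts => //= t ts IH; rewrite -/(flat3 ts) IH; lia. Qed.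

Lemma size_flat2 (ms : seq (V * V)) : size (flat2 ms) = (2 * size ms)%N.
Proof. by elim: ms => //= t ts IH; rewrite -/(flat2 ts) IH; lia. Qed.

Lemma perm_flat3 (ts ts' : seq (V * V * V)) : perm_eq ts ts' -> perm_eq (flat3 ts) (flat3 ts').
Proof. by move=> h; apply: perm_flatten; apply: perm_map. Qed.

Lemma perm_flat2 (ms ms' : seq (V * V)) : perm_eq ms ms' -> perm_eq (flat2 ms) (flat2 ms').
Proof. by move=> h; apply: perm_flatten; apply: perm_map. Qed.

(** * Exchange arguments for a configuration maximal first in tiles, then in double edges *)

Section Optimal.
Variables (u : seq V) (ts : seq (V * V * V)) (ms : seq (V * V)) (l : seq V).
Hypothesis hts : all tri3 ts.
Hypothesis hms : all double ms.
Hypothesis hu : perm_eq (flat3 ts ++ flat2 ms ++ l) u.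
Hypothesis opt_ts : forall ts' l', all tri3 ts' -> perm_eq (flat3 ts' ++ l') u ->
  (size ts' <= size ts)%N.
Hypothesis opt_ms : forall ts' ms' l', size ts' = size ts -> all tri3 ts' -> all double ms' ->
  perm_eq (flat3 ts' ++ flat2 ms' ++ l') u -> (size ms' <= size ms)%N.

Lemma double_tri x a p : mu x a = 2 -> (3 <= mu x p + mu a p)%N -> tri x a p.
Proof.
by move=> h1; have := hM x p; have := hM a p; rewrite /tri h1; lia.
Qed.

Lemma no_tri_left L' x a z : perm_eq (flat2 ms ++ l) [:: x, a, z & L'] -> ~~ tri x a z.
Proof.
move=> hp; apply/negP => ht.
have := @opt_ts ((x, a, z) :: ts) L'; rewrite /= [tri3 (x, a, z)]ht hts ltnn => /(_ isT) h.
suff : is_true false by []; apply: h; apply: perm_trans hu.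
rewrite -/(flat3 ts); move/permP: hp => hp; apply/permP => P; have := hp P.
by count_lia.
Qed.

(** A leftover vertex receiving three edges from the pair would form a new tile with it, against the
    maximality of [ts]. *)
Lemma pair_left_sum x a : (x, a) \in ms ->
  (\sum_(z <- flat2 ms ++ l) (mu x z + mu a z) <= 2 * size (flat2 ms ++ l))%N.
Proof.
move=> xa; have xa2 := allP hms _ xa; move/eqP: xa2 => /= xa2.
have hp : perm_eq (flat2 ms ++ l) [:: x, a & flat2 (rem (x, a) ms) ++ l].
  rewrite -[X in perm_eq _ X]/(flat2 ((x,a) :: rem (x, a) ms) ++ l) perm_cat2r.
  by apply: perm_flat2; apply: perm_to_rem.
set L' := flat2 (rem _ _) ++ l in hp.
rewrite (perm_big _ hp) (perm_size hp) /= !big_cons !mult_loopless (mult_sym M a x) xa2.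
suff : (\sum_(z <- L') (mu x z + mu a z) <= 2 * size L')%N by lia.
rewrite mulnC; apply: sum_le_const => z hz; rewrite leqNgt; apply/negP => h3.
have hz2 : perm_eq (flat2 ms ++ l) [:: x, a, z & rem z L'].
  by apply: (perm_trans hp); rewrite !perm_cons; apply: perm_to_rem.
by have := no_tri_left hz2; rewrite double_tri.
Qed.

(** A double edge inside [l] would enlarge the matching. *)
Lemma left_single x : x \in l -> (\sum_(y <- l) mu x y <= size l)%N.
Proof.
move=> xl; have hp := perm_to_rem xl; rewrite (perm_big _ hp) (perm_size hp) /= big_cons.
rewrite mult_loopless add0n; apply: leqW.
rewrite -[X in (_ <= X)%N]muln1; apply: sum_le_const => y hy; rewrite leqNgt; apply/negP => h2.
have xy : mu x y == 2 by have := hM x y; lia.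
have := @opt_ms ts ((x, y) :: ms) (rem y (rem x l)) erefl hts.
rewrite /= hms ltnn andbT => /(_ xy) h.
suff : is_true false by []; apply: h; apply: perm_trans hu.
have hp' := perm_to_rem hy; move/permP: hp => hp; move/permP: hp' => hp'.
by apply/permP => P; move: (hp P) (hp' P); count_lia.
Qed.

(** Since 4 + 2 + 2 < 9, such a pair sends at least 3 edges to each of two vertices of [t]. Two such
    pairs can therefore choose different vertices, which replaces [t] by two tiles and frees the
    third vertex. *)
Lemma pairs_at_tile t : t \in ts ->
  (count (fun p => 9 <= wt p.1 t + wt p.2 t) ms <= 1)%N.
Proof.
move=> tts; apply: count_le1 => -[x a] [x' a'] ms' hp.
have hd : all double [:: (x, a), (x', a') & ms'] by rewrite -(perm_all _ hp).
move: hd => /= /and3P[/eqP/= d1 /eqP/= d2 _].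
case: t tts => -[p q] r tts; rewrite /wt /= => h1 h2.
have hpt := perm_to_rem tts.
have htr : all tri3 (rem (p, q, r) ts).
  by have := hts; rewrite (perm_all _ hpt) => /andP[].
have key y z w : perm_eq [:: y; z; w] [:: p; q; r] ->
   tri x a y -> tri x' a' z -> False.
  move=> hyz t1 t2.
  have := @opt_ts [:: (x, a, y), (x', a', z) & rem (p, q, r) ts] (w :: flat2 ms' ++ l).
  rewrite /= [tri3 (x, a, y)]t1 [tri3 (x', a', z)]t2 htr => /(_ isT) h.
  suff : ((size (rem (p, q, r) ts)).+2 <= size ts)%N by rewrite (perm_size hpt) ltnn.
  apply: h; apply: perm_trans hu; rewrite -/(flat3 _).
  move/perm_flat3/permP: hpt => h1'; move/perm_flat2/permP: hp => h2'.
  move/permP: hyz => h3'; apply/permP => P; move: (h1' P) (h2' P) (h3' P).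
  by count_lia.
have T1 := double_tri d1; have T2 := double_tri d2.
have := (hM x p, hM x q, hM x r); have := (hM a p, hM a q, hM a r).
have := (hM x' p, hM x' q, hM x' r); have := (hM a' p, hM a' q, hM a' r).
move=> [[b1 b2] b3] [[b4 b5] b6] [[b7 b8] b9] [[b10 b11] b12].
have : [|| (3 <= mu x p + mu a p) && (3 <= mu x' q + mu a' q),
  (3 <= mu x p + mu a p) && (3 <= mu x' r + mu a' r),
  (3 <= mu x q + mu a q) && (3 <= mu x' p + mu a' p),
  (3 <= mu x q + mu a q) && (3 <= mu x' r + mu a' r),
  (3 <= mu x r + mu a r) && (3 <= mu x' p + mu a' p) |
  (3 <= mu x r + mu a r) && (3 <= mu x' q + mu a' q)]%N.
  by clear -h1 h2 b1 b2 b3 b4 b5 b6 b7 b8 b9 b10 b11 b12; lia.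
case/or4P => [/andP[/T1 + /T2]|/andP[/T1 + /T2]|/andP[/T1 + /T2]|].
- by apply: (key _ _ r); perm_tac.
- by apply: (key _ _ q); perm_tac.
- by apply: (key _ _ r); perm_tac.
case/or3P => /andP[/T1 + /T2].
- by apply: (key _ _ p); perm_tac.
- by apply: (key _ _ q); perm_tac.
- by apply: (key _ _ p); perm_tac.
Qed.

(** Of two such vertices, one takes the place of [p] in the tile and the other forms a double edge
    with the freed [p]: the same number of tiles, but a larger matching. *)
Lemma swap_unique t p q r : t \in ts -> perm_eq [:: p; q; r] [:: t.1.1; t.1.2; t.2] ->
  (count (fun x => (mu x p == 2) && tri x q r) l <= 1)%N.
Proof.
move=> tts hpq; apply: count_le1 => x x' l' hp /andP[_ h1] /andP[/eqP h2 _].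
have hpt := perm_to_rem tts.
have htr : all tri3 (rem t ts).
  by have := hts; rewrite (perm_all _ hpt) => /andP[].
have := @opt_ms ((x, q, r) :: rem t ts) ((x', p) :: ms) l'.
rewrite /= [tri3 (x, q, r)]h1 htr hms /double /double_adj h2 ltnn /=.
move=> /(_ (esym (perm_size hpt)) isT isT) h.
suff : is_true false by []; apply: h; apply: perm_trans hu.
move/perm_flat3/permP: hpt => h1'; move/permP: hp => h2'.
move/permP: hpq => h3'; apply/permP => P; move: (h1' P) (h2' P) (h3' P).
by count_lia.
Qed.

(** At most one pair from [x] to the tile is simple, and at most one inside the tile, so some double
    neighbour of [x] can be exchanged for [x]. *)
Lemma heavy_swap x p q r : tri p q r -> (5 <= wt x (p, q, r))%N ->
  [|| (mu x p == 2) && tri x q r, (mu x q == 2) && tri x p r | (mu x r == 2) && tri x p q].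
Proof.
rewrite /tri /wt /=; have := (hM x p, hM x q, hM x r, hM p q, hM q r, hM p r).
by move=> [[[[[]]]]]; lia.
Qed.

(** A weight exceeds 4 by at most 2, and by [heavy_swap] a vertex of weight above 4 is counted on
    the right at least once. *)
Lemma sum_wt_le (p q r : V) (s : seq V) : tri p q r ->
  (\sum_(x <- s) wt x (p, q, r) <= 4 * size s + 2 * (
   count (fun x => (mu x p == 2) && tri x q r) s +
   count (fun x => (mu x q == 2) && tri x p r) s +
   count (fun x => (mu x r == 2) && tri x p q) s))%N.
Proof.
move=> pqr; elim: s => [|x s IH]; first by rewrite big_nil.
rewrite big_cons /=.
have w6 := wt_le6 x (p, q, r).
have := @heavy_swap x p q r pqr; move: w6 IH.
move: (bigop.body _ _ _) (wt _ _) (_ && _) (_ && _) (_ && _) (count _ s) (count _ s) (count _ s).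
move=> S w b1 b2 b3 k1 k2 k3 w6 IH; have [h5 /(_ isT)|h5 _] := leqP 5 w; last lia.
by case: b1; case: b2; case: b3 => //=; lia.
Qed.

Lemma lefts_at_tile t : t \in ts -> (\sum_(x <- l) wt x t <= 4 * size l + 6)%N.
Proof.
move=> tts; have := allP hts _ tts; case: t tts => -[p q] r tts; rewrite /tri3 /= => pqr.
have c1 := @swap_unique _ p q r tts (perm_refl _).
have c2 : (count (fun x => (mu x q == 2) && tri x p r) l <= 1)%N.
  by apply: (swap_unique tts); perm_tac.
have c3 : (count (fun x => (mu x r == 2) && tri x p q) l <= 1)%N.
  by apply: (swap_unique tts); perm_tac.
apply: (leq_trans (sum_wt_le l pqr)); rewrite leq_add2l.
by move: c1 c2 c3; do 3![move: (count _ l) => ?]; lia.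
Qed.

Lemma pairs_at_tile_sum t : t \in ts ->
  (\sum_(p <- ms) (wt p.1 t + wt p.2 t) <= 8 * size ms + 4)%N.
Proof.
move=> tts; have := pairs_at_tile tts.
suff : (\sum_(p <- ms) (wt p.1 t + wt p.2 t) <=
  8 * size ms + 4 * count (fun p => 9 <= wt p.1 t + wt p.2 t) ms)%N by lia.
elim: (ms) => [|[x a] m' IH]; first by rewrite big_nil.
rewrite big_cons /=; move: (wt_le6 x t) (wt_le6 a t) IH.
move: (bigop.body _ _ _) (wt x t) (wt a t) (count _ m') => S w1 w2 k h1 h2 IH.
by have [h9|h9] := leqP 9 (w1 + w2) => /=; lia.
Qed.

Variables (R : realType) (eps : R).
Hypothesis heps : 0 < eps.
Notation n := ((size u)%:R : R).
Hypothesis hdeg : forall x, x \in u -> (4 / 3 + eps) * n <= (\sum_(y <- u) mu x y)%N%:R.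
Hypothesis hn : 16 <= eps ^+ 2 * n.

Lemma sum_u x : (\sum_(y <- u) mu x y =
  \sum_(t <- ts) wt x t + \sum_(y <- flat2 ms ++ l) mu x y)%N.
Proof. by rewrite -(perm_big _ hu) big_cat /= sum_flat3. Qed.

Lemma size_u : (size u = 3 * size ts + size (flat2 ms ++ l))%N.
Proof. by rewrite -(size_flat3 ts) -size_cat; have := perm_size hu. Qed.

Lemma n_pos : 0 < n.
Proof.
rewrite lt_neqAle ler0n andbT; apply/eqP => h; move: hn; rewrite -h mulr0.
by rewrite lern0.
Qed.

(** The degrees of the matched vertices are summed in two ways. A pair sends on average little more
    than 8 edges to a tile and 2 to a leftover vertex, while the degree condition asks for
    [8 / 3 + 2 * eps] per vertex of [u]. *)
Lemma matching_small : (size ms)%:R * eps <= 2 / 3.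
Proof.
have n0 := n_pos.
have h1 : (\sum_(p <- ms) (\sum_(y <- u) mu p.1 y + \sum_(y <- u) mu p.2 y) <=
   size ts * (8 * size ms + 4) + size ms * (2 * size (flat2 ms ++ l)))%N.
  under eq_bigr => p _ do rewrite !sum_u addnACA -!big_split /=.
  rewrite big_split /= exchange_big /=; apply: leq_add.
    by apply: sum_le_const => t /pairs_at_tile_sum.
  by apply: sum_le_const => -[x a] /pair_left_sum.
have h2 : (size ms)%:R * (2 * ((4 / 3 + eps) * n)) <=
   (\sum_(p <- ms) (\sum_(y <- u) mu p.1 y + \sum_(y <- u) mu p.2 y))%N%:R.
  rewrite natr_sum; apply: sum_ge_const => -[x a] xa; rewrite natrD /=.
  have [xu au] : x \in u /\ a \in u.
    rewrite -!(perm_mem hu) !mem_cat.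
    have hx : x \in flat2 ms by apply/flattenP; exists [:: x; a]; [apply/mapP; exists (x, a) | rewrite mem_head].
    have ha : a \in flat2 ms by apply/flattenP; exists [:: x; a]; [apply/mapP; exists (x, a) | rewrite !inE eqxx orbT].
    by rewrite hx ha !orbT.
  by have := hdeg xu; have := hdeg au; lra.
move: h1; rewrite -(ler_nat R) => h1; have := le_trans h2 h1.
have := size_u; move/(congr1 (fun k => k%:R : R)); rewrite natrD !natrM => h3.
rewrite natrD !natrM natrD natrM.
set m := (size ms)%:R; set L := (size (flat2 ms ++ l))%:R in h3 *; set k := (size ts)%:R in h3 *.
have L0 : 0 <= L by rewrite ler0n.
have m0 : 0 <= m by rewrite ler0n.
have k0 : 0 <= k by rewrite ler0n.
rewrite !h3 in n0 *.
move=> h4; have mL : 0 <= m * L by rewrite mulr_ge0.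
rewrite -(ler_pM2r n0); lra.
Qed.

Lemma left_small : (size l)%:R * eps <= 4.
Proof.
have n0 := n_pos.
have h1 : (\sum_(x <- l) \sum_(y <- u) mu x y <=
   size ts * (4 * size l + 6) + size l * (4 * size ms + size l))%N.
  under eq_bigr => p _ do rewrite sum_u.
  rewrite big_split /= exchange_big /=; apply: leq_add.
    by apply: sum_le_const => t /lefts_at_tile.
  apply: sum_le_const => x xl; rewrite big_cat /=.
  apply: leq_add; last exact: left_single.
  have -> : (4 * size ms = 2 * size (flat2 ms))%N by rewrite (size_flat2 ms); lia.
  by rewrite mulnC; apply: sum_le_const => y _; apply: hM.
have h2 : (size l)%:R * ((4 / 3 + eps) * n) <= (\sum_(x <- l) \sum_(y <- u) mu x y)%N%:R.
  rewrite natr_sum; apply: sum_ge_const => x xl; apply: hdeg.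
  by rewrite -(perm_mem hu) !mem_cat xl !orbT.
move: h1; rewrite -(ler_nat R) => h1; have := le_trans h2 h1.
have := size_u; move/(congr1 (fun k => k%:R : R)); rewrite size_cat (size_flat2 ms) !natrD !natrM => h3.
rewrite !(natrD, natrM).
have := matching_small; have := hn.
set m := (size ms)%:R in h3 *; set L := (size l)%:R in h3 *; set k := (size ts)%:R in h3 *.
have L0 : 0 <= L by rewrite ler0n.
have m0 : 0 <= m by rewrite ler0n.
have k0 : 0 <= k by rewrite ler0n.
move=> hn' hm h4.
(* By [matching_small] and [hn]; the edges from [l] to the matching then use up at most half of the
   surplus [eps * n]. *)
have h5 : 8 * m <= eps * n.
  by rewrite -(ler_pM2l heps); lra.
have h6 : L * (eps * n - 4 * m) <= 2 * n.
  have : L * n = 3 * (k * L) + 2 * (L * m) + L * L by rewrite h3; ring.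
  have : 0 <= L * m by rewrite mulr_ge0.
  have : 0 <= L * L by rewrite mulr_ge0.
  lra.
have h7 : L * (eps * n / 2) <= L * (eps * n - 4 * m) by rewrite ler_wpM2l //; lra.
by rewrite -(ler_pM2r n0); lra.
Qed.
End Optimal.

Lemma near_tiling (R : realType) (eps : R) (u : seq V) : 0 < eps ->
  (forall x, x \in u -> (4 / 3 + eps) * (size u)%:R <= (\sum_(y <- u) mu x y)%N%:R) ->
  16 <= eps ^+ 2 * (size u)%:R ->
  exists ts L, [/\ all tri3 ts, perm_eq (flat3 ts ++ L) u & (size L)%:R * eps <= 6].
Proof.
move=> heps hdeg hn.
pose conf k m := exists ts ms l, [/\ size ts = k, size ms = m, all tri3 ts, all double ms &
  perm_eq (flat3 ts ++ flat2 ms ++ l) u].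
(* Two successive maximizations: the number of tiles, then the size of the matching for that number
   of tiles. *)
pose P1 k := `[< exists m, conf k m >].
have [||k /asboolP[m0 hm0] hk] := @ex_maxnP P1 (size u) _ _.
- by exists 0; apply/asboolP; exists 0, [::], [::], u; rewrite /= perm_refl.
- move=> k /asboolP[m [ts [ms [l [<- _ _ _ /perm_size <-]]]]].
  by rewrite size_cat (size_flat3 ts); lia.
have [||m /asboolP[ts [ms [l [sts sms hts hms hp]]]] hm] := @ex_maxnP (fun m => `[< conf k m >]) (size u) _ _.
- by exists m0; apply/asboolP.
- move=> m /asboolP[ts [ms [l [_ <- _ _ /perm_size <-]]]].
  by rewrite !size_cat (size_flat2 ms); lia.
have o1 ts' l' : all tri3 ts' -> perm_eq (flat3 ts' ++ l') u -> (size ts' <= size ts)%N.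
  move=> h1 h2; rewrite sts; apply: hk; apply/asboolP; exists 0, ts', [::], l'.
  by split.
have o2 ts' ms' l' : size ts' = size ts -> all tri3 ts' -> all double ms' ->
    perm_eq (flat3 ts' ++ flat2 ms' ++ l') u -> (size ms' <= size ms)%N.
  move=> h0 h1 h2 h3; rewrite sms; apply: hm; apply/asboolP; exists ts', ms', l'.
  by split=> //; rewrite h0.
exists ts, (flat2 ms ++ l); split => //.
have := matching_small hts hms hp o1 hdeg hn.
have := left_small hts hms hp o1 o2 heps hdeg hn.
by rewrite size_cat (size_flat2 ms) natrD natrM; lra.
Qed.

End NearTiling.

(** * Reachability classes *)

Lemma card_setU_le (R : realType) (T : finType) (A B : {set T}) :
  (#|A :|: B|%:R <= #|A|%:R + #|B|%:R :> R).
Proof. by rewrite -natrD ler_nat; apply: leq_card_setU. Qed.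

Lemma card_sub_le (R : realType) (T : finType) (A B : {set T}) :
  A \subset B -> (#|A|%:R <= #|B|%:R :> R).
Proof. by rewrite ler_nat; apply: subset_leq_card. Qed.

Section Reach.
Variables (R : realType) (V : finType) (M : multigraph V).
Notation mu := (mult M).
Notation tri := (tri M).
Notation tileable := (tileable M).
Notation n := (#|V|%:R : R).

Definition reach (c : R) k x y :=
  many c k (fun s => tileable (x :: s) /\ tileable (y :: s)).

Lemma reach_sym c k x y : reach c k x y -> reach c k y x.
Proof. by apply: many_mono => // s []. Qed.

Lemma reach_le c c' k x y : c' <= c -> reach c k x y -> reach c' k x y.
Proof. by move=> h; apply: many_mono. Qed.

Definition NH x := [set y | mu x y == 2].
Definition NG x := [set y | 0 < mu x y]%N.

Definition hedge (p : V * V) := mu p.1 p.2 == 2.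

Definition apexes (p : V * V) := [set z | tri z p.1 p.2].

Definition bases x := [set p | hedge p && tri x p.1 p.2].

Hypothesis hM : standard M.

Lemma degreeE x : degree M x = (#|NG x| + #|NH x|)%N.
Proof.
rewrite /degree -!sum1_card [X in (X + _)%N]big_mkcond [X in (_ + X)%N]big_mkcond -big_split /=.
by apply: eq_bigr => y _; rewrite !inE; have := hM x y; case: (mu x y) => [|[|[]]].
Qed.

(** A vertex receiving more than 2 edges from a double edge is one of its apexes, and it receives at
    most 4. *)
Lemma hedge_degree_in p (X : {set V}) : hedge p ->
  (\sum_(z in X) mu p.1 z + \sum_(z in X) mu p.2 z <= 2 * #|X| + 2 * #|apexes p :&: X|)%N.
Proof.
move=> /eqP hp; rewrite -big_split /= -!sum1_card !big_distrr /=.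
rewrite [X in (_ <= _ + X)%N](eq_bigl (fun i => (i \in X) && (i \in apexes p))); last first.
  by move=> z; rewrite inE andbC.
rewrite [X in (_ <= _ + X)%N]big_mkcondr -big_split /=; apply: leq_sum => z zX.
rewrite inE /tri (mult_sym M z p.1) (mult_sym M z p.2) hp.
have := hM p.1 z; have := hM p.2 z.
case: ifP; lia.
Qed.

Variable eps : R.
Hypothesis (heps : 0 < eps) (heps1 : eps <= 1 / 10).
Hypothesis V0 : (0 < #|V|)%N.
Hypothesis hdeg : forall x, (4 / 3 + eps) * n <= (degree M x)%:R.

Let n0 : 0 < n. Proof. by rewrite ltr0n. Qed.

Lemma card_NH x : (1 / 3 + eps) * n <= #|NH x|%:R.
Proof.
have := hdeg x; rewrite degreeE natrD.
have : #|NG x|%:R <= n by rewrite ler_nat max_card.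
lra.
Qed.

Lemma card_NG x : (2 / 3 + eps / 2) * n <= #|NG x|%:R.
Proof.
have := hdeg x; rewrite degreeE natrD.
have : (#|NH x|%:R : R) <= #|NG x|%:R.
  by rewrite ler_nat; apply: subset_leq_card; apply/fintype.subsetP => y; rewrite !inE; lia.
lra.
Qed.

Lemma card_apexes p : hedge p -> (1 / 3 + eps) * n <= #|apexes p|%:R.
Proof.
move=> hp; have := hedge_degree_in [set: V] hp; rewrite setIT cardsT -(ler_nat R).
rewrite natrD [X in _ <= X]natrD !natrM.
have e x : (\sum_(z in [set: V]) mu x z)%N = degree M x.
  by apply: eq_bigl => z; rewrite inE.
rewrite !e; have := hdeg p.1; have := hdeg p.2; lra.
Qed.

(** Take [a] in [NH x] and [b] in the intersection of [NH a] and [NG x]; the sizes of the last two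
    sets add up to more than [(1 + eps) * n]. *)
Lemma card_bases x : eps / 3 * n ^+ 2 <= #|bases x|%:R.
Proof.
have h a : a \in NH x -> eps * n <= #|[set b | (a, b) \in bases x]|%:R.
  move=> ha; have h1 : NH a :&: NG x \subset [set b | (a, b) \in bases x].
    apply/fintype.subsetP => b; move: ha; rewrite !inE /= /hedge /tri /= => /eqP -> /andP[/eqP ->].
    by rewrite eqxx; lia.
  have := subset_leq_card h1; rewrite -(ler_nat R); apply: le_trans.
  have := cardsUI (NH a) (NG x); move/(congr1 (fun k => k%:R : R)); rewrite !natrD.
  have : #|NH a :|: NG x|%:R <= n by rewrite ler_nat max_card.
  have := card_NH a; have := card_NG x; have := mulr_gt0 heps n0; lra.
rewrite card_fibers natr_sum.
apply: le_trans (_ : _ <= \sum_(a in NH x) (eps * n)) _.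
  rewrite sumr_const -mulr_natr; have := card_NH x.
  have h2 : 0 < eps * n by rewrite mulr_gt0.
  move=> h3; have : eps * n * ((1/3 + eps) * n) <= eps * n * #|NH x|%:R by rewrite ler_pM2l.
  have : 0 <= (eps * n) ^+ 2 by rewrite sqr_ge0.
  lra.
rewrite [X in _ <= X](bigID (mem (NH x))) /= -[X in X <= _]addr0; apply: lerD.
  by apply: ler_sum => a; apply: h.
by apply: sumr_ge0.
Qed.

Definition rel_bases p q := eps * n <= #|apexes p :&: apexes q|%:R.

Lemma rel_basesC p q : rel_bases p q = rel_bases q p.
Proof. by rewrite /rel_bases setIC. Qed.

(** Three sets of size [(1 / 3 + eps) * n] with pairwise intersections below [eps * n] do not fit
    into [V]. *)
Lemma rel_bases3 p q r : hedge p -> hedge q -> hedge r ->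
  [|| rel_bases p q, rel_bases p r | rel_bases q r].
Proof.
move=> hp hq hr; apply/negPn/negP; rewrite !negb_or -!ltNge => /and3P[h1 h2 h3].
have := card_apexes hp; have := card_apexes hq; have := card_apexes hr.
move: h1 h2 h3; move: (apexes p) (apexes q) (apexes r) => A B C h1 h2 h3.
have := cardsUI A B; have := cardsUI (A :|: B) C; rewrite setIUl.
have h4 := card_setU_le R (A :&: C) (B :&: C).
move/(congr1 (fun k => k%:R : R)); rewrite !natrD => h5.
move/(congr1 (fun k => k%:R : R)); rewrite !natrD => h6.
have : #|A :|: B :|: C|%:R <= n by rewrite ler_nat max_card.
lra.
Qed.

Lemma reach5 th x y : 0 < th -> th <= eps ->
  th * n ^+ 2 <= #|[set p in bases x | th * n ^+ 2 <= #|[set q in bases y | rel_bases p q]|%:R]|%:R ->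
  reach (th / 2) 5 x y.
Proof.
move=> th0 th1 h; apply: (many_pair V0 (ltW th0) h) => a b.
rewrite !inE => /andP[/andP[_ t1] h2].
apply: (many_pair V0 (ltW th0) h2) => a' b'.
rewrite !inE => /andP[/andP[_ t2]] hr.
apply: (many_le1 (le_trans _ hr)); first by rewrite ler_pM2r //; lra.
move=> w; rewrite !inE /= => /andP[w1 w2]; split.
  apply: (@tileable_perm _ _ ([:: x; a; b] ++ [:: w; a'; b'])); first by perm_tac.
  by apply: tileable_cat; apply: tileable_tri.
apply: (@tileable_perm _ _ ([:: y; a'; b'] ++ [:: w; a; b])); first by perm_tac.
by apply: tileable_cat; apply: tileable_tri.
Qed.

(** As in [reach5], but through an intermediate pair [(f, g)]: [w] is an apex common to [(a, b)] and
    [(f, g)], and [w'] one common to [(f, g)] and [(a', b')]. *)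
Lemma reach8 de x y (Bx By : {set V * V}) : 0 < de -> de <= eps ->
  Bx \subset bases x -> By \subset bases y ->
  de * n ^+ 2 <= #|Bx|%:R -> de * n ^+ 2 <= #|By|%:R ->
  (forall p q, p \in Bx -> q \in By ->
     de * n ^+ 2 <= #|[set f | rel_bases p f && rel_bases q f]|%:R) ->
  reach (de / 2) 8 x y.
Proof.
move=> de0 de1 /fintype.subsetP sx /fintype.subsetP sy hx hy h.
apply: (many_pair V0 (ltW de0) hx) => a b hab.
have := sx _ hab; rewrite inE => /andP[_ /= t1].
apply: (many_pair V0 (ltW de0) hy) => a' b' hab'.
have := sy _ hab'; rewrite inE => /andP[_ /= t2].
apply: (many_pair V0 (ltW de0) (h _ _ hab hab')) => f g; rewrite inE => /andP[r1 r2].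
have d2 : de / 2 * n <= eps * n by rewrite ler_pM2r //; lra.
apply: (@many_cat _ _ (de / 2) 1 1 (fun s => exists2 w, s = [:: w] & w \in apexes (a, b) :&: apexes (f, g))); last first.
  by apply: (many_le1 (le_trans d2 r1)) => w hw; exists w.
move=> s [w -> hw]; apply: (many_le1 (le_trans d2 r2)) => w' hw'.
move: hw hw'; rewrite !inE /= => /andP[w1 w2] /andP[w3 w4]; split.
  apply: (@tileable_perm _ _ ([:: x; a; b] ++ [:: w; f; g] ++ [:: w'; a'; b'])); first by perm_tac.
  by do 2?[apply: tileable_cat]; apply: tileable_tri.
apply: (@tileable_perm _ _ ([:: y; a'; b'] ++ [:: w'; f; g] ++ [:: w; a; b])); first by perm_tac.
by do 2?[apply: tileable_cat]; apply: tileable_tri.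
Qed.

(** Double counting of pairs in [D] with their apexes. Vertices outside the set account for at most
    [eps ^+ 2 / 6 * n ^+ 3] incidences, which the surplus [eps * n] in [card_apexes] pays for, so
    the bound is a full third. *)
Lemma card_typed (T : pred (V * V)) (D : {set V * V}) :
  eps / 6 * n ^+ 2 <= #|D|%:R -> (forall p, p \in D -> hedge p && T p) ->
  (#|V| <= 3 * #|[set z | (eps ^+ 2 / 6 * n ^+ 2 <= #|[set p in bases z | T p]|%:R)%R]|)%N.
Proof.
move=> hD hT; set A := [set z | _].
have e : (\sum_(p in D) #|apexes p| = \sum_(z : V) #|[set p in D | z \in apexes p]|)%N.
  under eq_bigr => t _ do rewrite -sum1_card.
  under [RHS]eq_bigr => z _ do rewrite -sum1_card.
  under [RHS]eq_bigr => z _ do (under eq_bigl => t do rewrite inE).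
  by rewrite (exchange_big_dep predT) //=.
have h1 : #|D|%:R * ((1 / 3 + eps) * n) <= (\sum_(p in D) #|apexes p|)%N%:R.
  rewrite natr_sum mulr_natl -sumr_const; apply: ler_sum => p pD; apply: card_apexes.
  by case/andP: (hT _ pD).
have h2 : (\sum_(z : V) #|[set p in D | z \in apexes p]|)%N%:R <=
   \sum_(z : V) ((z \in A)%:R * #|D|%:R + eps ^+ 2 / 6 * n ^+ 2).
  rewrite natr_sum; apply: ler_sum => z _; have [zA|zA] := boolP (z \in A).
    rewrite mul1r; apply: ler_wpDr; first by rewrite mulr_ge0 ?sqr_ge0 // divr_ge0 ?sqr_ge0.
    by rewrite ler_nat; apply: subset_leq_card; apply/fintype.subsetP => p; rewrite inE => /andP[].
  rewrite mul0r add0r; move: zA; rewrite inE -ltNge => /ltW; apply: le_trans.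
  rewrite ler_nat; apply: subset_leq_card; apply/fintype.subsetP => p.
  by rewrite !inE => /andP[/hT/andP[-> ->] ->].
rewrite big_split /= sumr_const -mulr_suml -natr_sum in h2.
have e2 : (\sum_(z : V) (z \in A) = #|A|)%N by rewrite -sum1_card [RHS]big_mkcond.
rewrite e2 -[_ *+ #|_|]mulr_natr -e in h2; have h := le_trans h1 h2.
rewrite -(ler_nat R) natrM.
have D0 : 0 < (#|D|%:R : R).
  by apply: lt_le_trans hD; rewrite mulr_gt0 // ?exprn_gt0 // divr_gt0.
have h3 : eps * n * (eps / 6 * n ^+ 2) <= eps * n * #|D|%:R.
  by rewrite ler_pM2l // mulr_gt0.
rewrite -(ler_pM2l D0); lra.
Qed.

(** If the complement of [B] is smaller than a third, it is enlarged inside [A] to exactly a third,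
    an integer by divisibility. *)
Lemma between_sets (A B : {set V}) : A :|: B = setT ->
  (3 %| #|V|)%N -> (#|V| <= 3 * #|A|)%N -> (#|V| <= 3 * #|B|)%N ->
  exists C : {set V}, [/\ C \subset A, ~: C \subset B,
    (#|V| <= 3 * #|C|)%N & (#|V| <= 3 * #|~: C|)%N].
Proof.
move=> AB d3 hA hB.
have sub : ~: B \subset A.
  apply/fintype.subsetP => z; rewrite inE => zB.
  have : z \in A :|: B by rewrite AB inE.
  by rewrite inE (negbTE zB) orbF.
have cB := cardsC B.
have [h|h] := leqP #|V| (3 * #|~: B|).
  by exists (~: B); rewrite setCK.
have [k Vk] := dvdnP d3.
pose s := enum (~: B) ++ enum (A :\: ~: B).
have us : uniq s.
  rewrite cat_uniq !enum_uniq /= andbT; apply/hasPn => z; rewrite !mem_enum.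
  by rewrite !inE => /andP[].
have ss : size s = #|A|.
  by rewrite size_cat -!cardE -(cardsID (~: B) A) (setIidPr sub).
pose C := [set z in take k s].
have cC : #|C| = k.
  rewrite cardsE (card_uniqP _) ?take_uniq // size_takel // ss; lia.
exists C; split.
- apply/fintype.subsetP => z; rewrite inE => /mem_take; rewrite mem_cat !mem_enum.
  by case/orP => [/(fintype.subsetP sub)|] //; rewrite inE => /andP[].
- rewrite -[B]setCK setCS; apply/fintype.subsetP => z zB.
  rewrite inE take_cat; case: ifP => [|_].
    by rewrite -cardE => hk; move: h; rewrite Vk; lia.
  by rewrite mem_cat mem_enum zB.
- by rewrite cC; lia.
- by have := cardsC C; rewrite cC; lia.
Qed.

Lemma card_filter (A : {set V * V}) (P : pred (V * V)) :
  (#|A|%:R : R) = #|[set p in A | P p]|%:R + #|[set p in A | ~~ P p]|%:R.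
Proof.
rewrite -natrD; congr (_%:R); rewrite -(cardsID [set p | P p] A); congr (_ + _)%N.
  by apply: eq_card => p; rewrite !inE.
by apply: eq_card => p; rewrite !inE andbC.
Qed.

(** If some [x0], [y0] fail the criterion [cl] of [reach5], every double edge is related either to
    all of a large set [X0] of bases of [x0] or to almost all bases of [y0]. Vertices are classed by
    a type frequent among their bases, and [reach8] links two vertices of one class. *)
Lemma reach_dichotomy : (3 %| #|V|)%N ->
  (forall x y, reach (eps / 48) 5 x y) \/
  exists A : {set V}, [/\ (#|V| <= 3 * #|A|)%N, (#|V| <= 3 * #|~: A|)%N,
    {in A &, forall x y, reach (eps ^+ 2 / 12) 8 x y} &
    {in ~: A &, forall x y, reach (eps ^+ 2 / 12) 8 x y}].
Proof.
move=> d3; have e0 := heps; have e1 := heps1; have [th thE] : exists th : R, th = eps / 24 by exists (eps / 24).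
have thn : th * n ^+ 2 = eps * n ^+ 2 / 24 by rewrite thE; lra.
have th0 : 0 < th by lra.
have th1 : th <= eps by lra.
have thE2 : eps / 48 = th / 2 by lra.
pose cl x y := th * n ^+ 2 <=
  #|[set p in bases x | th * n ^+ 2 <= #|[set q in bases y | rel_bases p q]|%:R]|%:R.
have [h|h] := pselect (forall x y, cl x y).
  left=> x y; rewrite thE2.
  exact: (reach5 th0 th1 (h x y)).
right.
have [x0 [y0 /negP]] : exists x0 y0, ~ cl x0 y0.
  by apply: contrapT => hh; apply: h => x y; apply: contrapT => hxy; apply: hh; exists x, y.
rewrite /cl -ltNge => hx0.
have nn : 0 < n ^+ 2 by rewrite exprn_gt0.
have en : 0 < eps * n ^+ 2 by rewrite mulr_gt0.
pose X0 := [set p in bases x0 | ~~ (th * n ^+ 2 <= #|[set q in bases y0 | rel_bases p q]|%:R)].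
have cX0 : (eps / 3 - th) * n ^+ 2 <= #|X0|%:R.
  have := card_bases x0; rewrite (@card_filter (bases x0)
   (fun p => th * n ^+ 2 <= #|[set q in bases y0 | rel_bases p q]|%:R)).
  by rewrite -/X0; lra.
pose tX p := [forall q in X0, rel_bases p q].
have hedge_bases x p : p \in bases x -> hedge p by rewrite inE => /andP[].
have X0h p : p \in X0 -> hedge p by rewrite inE => /andP[/hedge_bases].
have X0r p : p \in X0 -> #|[set q in bases y0 | rel_bases p q]|%:R < th * n ^+ 2.
  by rewrite inE -ltNge => /andP[].
(* Both are related to few bases of [y0], so some base [f] of [y0] is related to neither, and
   [rel_bases3] applies. *)
have X0rel p q : p \in X0 -> q \in X0 -> rel_bases p q.
  move=> pX qX; have [f fb /norP[f1 f2]] : exists2 f, f \in bases y0 & ~~ (rel_bases p f || rel_bases q f).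
    apply: contrapT => hh.
    have hs : bases y0 \subset [set q in bases y0 | rel_bases p q] :|: [set f in bases y0 | rel_bases q f].
      apply/fintype.subsetP => f fb; rewrite !inE in fb *; rewrite fb /=.
      apply: contrapT => /negP hf; apply: hh; exists f => //.
      by rewrite inE.
    have := le_trans (card_sub_le R hs) (card_setU_le R _ _).
    have := X0r _ pX; have := X0r _ qX; have := card_bases y0; lra.
  have := rel_bases3 (X0h _ pX) (X0h _ qX) (hedge_bases _ _ fb).
  by rewrite (negbTE f1) (negbTE f2) !orbF.
pose tY p := #|[set q in bases y0 | ~~ rel_bases p q]|%:R <= th * n ^+ 2.
(* If [p] is unrelated to [q] in [X0], every base of [y0] unrelated to [p] is related to [q], and
   there are few of those. *)
have tXY p : hedge p -> ~~ tX p -> tY p.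
  move=> hp; rewrite negb_forall_in => /exists_inP[q qX pq].
  apply: le_trans (ltW (X0r _ qX)); rewrite ler_nat; apply: subset_leq_card.
  apply/fintype.subsetP => f; rewrite inE => /andP[fb pf]; rewrite inE fb /=.
  have := rel_bases3 hp (X0h _ qX) (hedge_bases _ _ fb).
  by rewrite (negbTE pq) (negbTE pf).
pose cls (T : pred (V * V)) := [set z | eps ^+ 2 / 6 * n ^+ 2 <= #|[set p in bases z | T p]|%:R].
have ee : eps ^+ 2 <= eps by rewrite expr2 -[X in _ <= X]mulr1 ler_pM2l //; lra.
have ee0 : 0 < eps ^+ 2 by rewrite exprn_gt0.
have e12 : eps ^+ 2 / 12 = eps ^+ 2 / 6 / 2 by lra.
have een : eps ^+ 2 * n ^+ 2 <= eps * n ^+ 2 by rewrite ler_pM2r.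
have cov : cls tX :|: cls tY = setT.
  apply/setP => z; rewrite !inE.
  have := card_bases z; rewrite (@card_filter (bases z) tX) => hz.
  have hs : (#|[set p in bases z | ~~ tX p]|%:R : R) <= #|[set p in bases z | tY p]|%:R.
    rewrite ler_nat; apply: subset_leq_card; apply/fintype.subsetP => p.
    by rewrite !inE => /andP[/andP[hp ->] /(tXY _ hp) ->]; rewrite hp.
  have h6 : eps ^+ 2 / 6 * n ^+ 2 <= eps / 6 * n ^+ 2.
    by lra.
  by apply/orP; case: (lerP (eps ^+ 2 / 6 * n ^+ 2) #|[set p in bases z | tX p]|%:R) => h7; [left|right; lra].
have hX0n0 : (0 < #|X0|)%N by rewrite -(ltr_nat R); apply: lt_le_trans cX0; lra.
have cA : (#|V| <= 3 * #|cls tX|)%N.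
  apply: (@card_typed tX X0); first by move: cX0; lra.
  move=> p pX; rewrite (X0h _ pX); apply/forall_inP => q qX; exact: X0rel.
have cB : (#|V| <= 3 * #|cls tY|)%N.
  apply: (@card_typed tY [set p in bases y0 | ~~ tX p]).
    have := card_bases y0; rewrite (@card_filter (bases y0) tX).
    have /card_gt0P[q qX] := hX0n0.
    suff : (#|[set p in bases y0 | tX p]|%:R : R) <= th * n ^+ 2 by lra.
    apply: le_trans (ltW (X0r _ qX)); rewrite ler_nat; apply: subset_leq_card.
    apply/fintype.subsetP => f; rewrite inE => /andP[fb /forall_inP hf]; rewrite inE fb /=.
    by rewrite rel_basesC hf.
  by move=> p; rewrite inE => /andP[/hedge_bases hp pX]; rewrite hp tXY.
(* The two classes may overlap; they are trimmed to a partition. *)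
have [C [CA CB c1 c2]] := between_sets cov d3 cA cB.
exists C; split=> // x y xC yC; rewrite e12.
- have := fintype.subsetP CA _ xC; have := fintype.subsetP CA _ yC; rewrite !inE => hy hx.
  apply: (reach8 _ _ _ _ hx hy); try (by lra); try by apply/fintype.subsetP => p; rewrite !inE => /andP[].
  move=> p q; rewrite !inE => /andP[_ /forall_inP tp] /andP[_ /forall_inP tq].
  apply: (@le_trans _ _ #|X0|%:R); first by move: cX0; lra.
  by rewrite ler_nat; apply: subset_leq_card; apply/fintype.subsetP => f fX; rewrite inE tp ?tq.
have := fintype.subsetP CB _ xC; have := fintype.subsetP CB _ yC; rewrite !inE => hy hx.
apply: (reach8 _ _ _ _ hx hy); try (by lra); try by apply/fintype.subsetP => p; rewrite !inE => /andP[].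
move=> p q; rewrite !inE => /andP[_ tp] /andP[_ tq].
(* All but at most [2 * th * n ^+ 2] bases of [y0] can serve as the intermediate edge. *)
have hs : bases y0 \subset [set f | rel_bases p f && rel_bases q f] :|:
   ([set f in bases y0 | ~~ rel_bases p f] :|: [set f in bases y0 | ~~ rel_bases q f]).
  apply/fintype.subsetP => f fb; rewrite !inE in fb *; rewrite fb /=.
  by case: (rel_bases p f); case: (rel_bases q f).
have := le_trans (card_sub_le R hs) (card_setU_le R _ _).
have := card_setU_le R [set f in bases y0 | ~~ rel_bases p f] [set f in bases y0 | ~~ rel_bases q f].
have := card_bases y0; move: tp tq; rewrite /tY; lra.
Qed.

End Reach.

(** * Merging the two classes *)

Section Merge.
Variables (R : realType) (V : finType) (M : multigraph V).
Notation mu := (mult M).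
Notation tri := (tri M).
Notation tileable := (tileable M).
Notation n := (#|V|%:R : R).

Definition tris (X Y Z : {set V}) : {set V * (V * V)} :=
  [set p | [&& p.1 \in X, p.2.1 \in Y, p.2.2 \in Z & tri p.1 p.2.1 p.2.2]].

Lemma card_tris_swap X Y Z : (#|tris X Y Z| = #|tris X Z Y|)%N.
Proof.
suff h X' Y' Z' : (#|tris X' Y' Z'| <= #|tris X' Z' Y'|)%N by apply/eqP; rewrite eqn_leq !h.
rewrite -(card_imset _ (f := fun p : V * (V * V) => (p.1, (p.2.2, p.2.1)))); last first.
  by move=> [a [b c]] [a' [b' c']] [] -> -> ->.
apply: subset_leq_card; apply/fintype.subsetP => q /imsetP[[a [b c]]].
by rewrite !inE /= => /and4P[h1 h2 h3 h4] -> /=; rewrite h1 h2 h3 -tri_swap.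
Qed.

Lemma card_tris_rot X Y Z : (#|tris X Y Z| = #|tris Y Z X|)%N.
Proof.
suff h X' Y' Z' : (#|tris X' Y' Z'| <= #|tris Y' Z' X'|)%N.
  by apply/eqP; rewrite eqn_leq h (leq_trans (h _ _ _) (h _ _ _)).
rewrite -(card_imset _ (f := fun p : V * (V * V) => (p.2.1, (p.2.2, p.1)))); last first.
  by move=> [a [b c]] [a' [b' c']] [] -> -> ->.
apply: subset_leq_card; apply/fintype.subsetP => q /imsetP[[a [b c]]].
by rewrite !inE /= => /and4P[h1 h2 h3 h4] -> /=; rewrite h1 h2 h3 -tri_rot.
Qed.

(** Take 5-triangles [u v w] and [u' v' w'] ending in [A] and [B], and connectors for the pairs
    [z w], [u u'], [v v'], [w' z']. With [z] added the first triangle is a tile, with [z'] the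
    second; the connectors match the remaining vertices. The length is 3 + 3 + 4 * 8 = 38. *)
Lemma reach_merge (g c : R) (X Y A B : {set V}) :
  (0 < #|V|)%N -> 0 <= g -> c = g / 4 ->
  {in X &, forall x y, reach M c 8 x y} -> {in Y &, forall x y, reach M c 8 x y} ->
  {in A &, forall x y, reach M c 8 x y} -> {in B &, forall x y, reach M c 8 x y} ->
  g * n ^+ 3 <= #|tris X Y A|%:R -> g * n ^+ 3 <= #|tris X Y B|%:R ->
  forall z z', z \in A -> z' \in B -> reach M c 38 z z'.
Proof.
move=> V0 g0 cg hX hY hA hB hxa hxb z z' zA zB; rewrite cg.
apply: (many_triple V0 g0 hxa) => u v w; rewrite inE /= => /and4P[uX vY wA t1].
apply: (many_triple V0 g0 hxb) => u' v' w'; rewrite inE /= => /and4P[uX' vY' wB t2].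
rewrite -cg.
apply: (@many_cat _ _ c 8 24 (fun s => tileable (z :: s) /\ tileable (w :: s)) _ _ (hA _ _ zA wA)) => s1 [a1 b1].
apply: (@many_cat _ _ c 8 16 (fun s => tileable (u :: s) /\ tileable (u' :: s)) _ _ (hX _ _ uX uX')) => s2 [a2 b2].
apply: (@many_cat _ _ c 8 8 (fun s => tileable (v :: s) /\ tileable (v' :: s)) _ _ (hY _ _ vY vY')) => s3 [a3 b3].
apply: (@many_mono _ _ c c 8 (fun s => tileable (w' :: s) /\ tileable (z' :: s)) _ (lexx c) _ (hB _ _ wB zB)) => s4 [a4 b4].
split.
  apply: (@tileable_perm _ _ ((z :: s1) ++ (u' :: s2) ++ (v' :: s3) ++ (w' :: s4) ++ [:: u; v; w])).
    by perm_tac.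
  by do 4![apply: tileable_cat => //]; apply: tileable_tri.
apply: (@tileable_perm _ _ ((w :: s1) ++ (u :: s2) ++ (v :: s3) ++ (z' :: s4) ++ [:: u'; v'; w'])).
  by perm_tac.
by do 4![apply: tileable_cat => //]; apply: tileable_tri.
Qed.

Hypothesis hM : standard M.
Variable eps : R.
Hypothesis (heps : 0 < eps) (heps1 : eps <= 1 / 10).
Hypothesis V0 : (0 < #|V|)%N.
Hypothesis hdeg : forall x, (4 / 3 + eps) * n <= (degree M x)%:R.

Let n0 : 0 < n. Proof. by rewrite ltr0n. Qed.

Lemma many_tri c (P : seq V -> Prop) : c <= eps / 6 ->
  (forall x y z, tri x y z -> P [:: x; y; z]) -> many c 3 P.
Proof.
move=> hc hP; have e0 := heps; have e1 := heps1.
apply: (@many_mono _ _ (eps / 3 / 2) _ _ P); first lra; first by [].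
apply: (@many_cat _ _ _ 1 2 (fun s => exists x, s = [:: x])); last first.
  apply: (@many_le1 _ _ _ setT) => [|x _]; last by exists x.
  by rewrite cardsT -[X in _ <= X]mul1r ler_pM2r //; lra.
move=> s [x ->]; have e3 : 0 <= eps / 3 by lra.
apply: (many_pair V0 e3 (card_bases hM heps heps1 V0 hdeg x)) => a b.
by rewrite inE => /andP[_ t]; apply: hP.
Qed.

Lemma many_tileable c m : c <= eps / 6 -> many c (3 * m) tileable.
Proof.
move=> hc; elim: m => [|m IH]; first exact: tileable_nil.
rewrite mulnS; apply: (@many_cat _ _ c 3 _ tileable); last first.
  by apply: many_tri => // x y z; apply: tileable_tri.
move=> s hs; apply: (many_mono (lexx c) _ IH) => s'; exact: tileable_cat.
Qed.

(** Appending whole tiles brings connectors of lengths 5 and 8 to the common length 38. *)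
Lemma reach_pad c k m x y : c <= eps / 6 -> reach M c k x y -> reach M c (k + 3 * m) x y.
Proof.
move=> hc; apply: many_cat => s [h1 h2]; apply: (many_mono (lexx c) _ (many_tileable m hc)) => s' h3.
by split; rewrite -cat_cons; apply: tileable_cat.
Qed.

Definition deg_in (X : {set V}) x := (\sum_(z in X) mu x z)%N.

Lemma degree_split X x : (degree M x = deg_in X x + deg_in (~: X) x)%N.
Proof.
rewrite /degree (bigID (mem X)) /=; congr (_ + _)%N.
by apply: eq_bigl => z; rewrite inE.
Qed.

Lemma deg_in_le X x : (deg_in X x <= 2 * #|X|)%N.
Proof. by rewrite mulnC -sum_nat_const; apply: leq_sum => z _; apply: hM. Qed.

(** * Partitions with few 5-triangles of types AAA and ABB *)

Section Barrier.
Variable A : {set V}.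

Definition homog a := [set q : V * V | tri a q.1 q.2 && ((q.1 \in A) == (q.2 \in A))].

Notation homogeneous X := {in X &, forall x y : V, (x \in A) = (y \in A)}.

(* The double neighbourhood of [a] inside [X] spans few edges, because each of them forms a 5-triangle with [a]. *)
Lemma card_NH_in a (X : {set V}) : #|homog a|%:R < eps ^+ 2 / 16 * n ^+ 2 -> homogeneous X ->
  #|NH M a :&: X|%:R <= (1 / 3 - eps / 4) * n.
Proof.
move=> ha hX; rewrite leNgt; apply/negP => ht; set S := NH M a :&: X in ht.
have e0 := heps; have e1 := heps1.
(* If [S] exceeds the bound, too few vertices lie outside it to carry the degree of [b]. *)
have hb b : b \in S -> eps / 4 * n <= #|S :&: NG M b|%:R.
  move=> bS.
  have h1 : (degree M b <= 2 * #|~: S| + 2 * #|S :&: NG M b|)%N.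
    rewrite (degree_split S) addnC; apply: leq_add; first exact: deg_in_le.
    rewrite /deg_in -sum1_card big_distrr /=.
    rewrite [X in (_ <= X)%N](eq_bigl (fun i => (i \in S) && (i \in NG M b))); last first.
      by move=> z; rewrite inE.
    rewrite [X in (_ <= X)%N]big_mkcondr /=; apply: leq_sum => z _.
    by have := hM b z; rewrite inE; case: ifP; lia.
  have := hdeg b; move: h1; rewrite -(ler_nat R) natrD !natrM.
  have := cardsC S; move/(congr1 (fun k => k%:R : R)); rewrite natrD.
  by have := n0; lra.
have hsub : (#|[set q : V * V | (q.1 \in S) && (q.2 \in S :&: NG M q.1)]|%:R : R) <= #|homog a|%:R.
  apply: card_sub_le; apply/fintype.subsetP => -[b b']; rewrite !inE /=.
  move=> /andP[/andP[/eqP h1 bX] /andP[/andP[/eqP h2 b'X] h3]].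
  by rewrite (hX _ _ bX b'X) eqxx andbT /tri h1 h2 h3; lia.
have h2 : #|S|%:R * (eps / 4 * n) <=
    #|[set q : V * V | (q.1 \in S) && (q.2 \in S :&: NG M q.1)]|%:R.
  rewrite card_fibers natr_sum [X in _ <= X](bigID (mem S)) /=.
  rewrite -[X in X <= _]addr0; apply: lerD; last exact: sumr_ge0.
  rewrite mulr_natl -sumr_const; apply: ler_sum => b bS.
  apply: (le_trans (hb _ bS)); apply: card_sub_le; apply/fintype.subsetP => z zS.
  by rewrite 2!inE /= bS.
have h3 : n / 4 * (eps / 4 * n) <= #|S|%:R * (eps / 4 * n).
  have en : eps * n <= 1 / 10 * n by rewrite ler_pM2r.
  have n4 : n / 4 <= #|S|%:R by have := n0; lra.
  by rewrite ler_wpM2r // mulr_ge0 ?ler0n // divr_ge0 // ltW.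
have h4 : eps * (eps * n ^+ 2) <= 1 * (eps * n ^+ 2).
  by rewrite ler_pM2r ?mulr_gt0 ?exprn_gt0 //; lra.
by move: h4; rewrite mulrA -expr2; lra.
Qed.

Lemma sum_homog (g : R) : #|tris A A A|%:R < g -> #|tris A (~: A) (~: A)|%:R < g ->
  \sum_(a in A) (#|homog a|%:R : R) < 2 * g.
Proof.
move=> h1 h2; pose D := [set p : V * (V * V) | (p.1 \in A) && (p.2 \in homog p.1)].
have hD : D \subset tris A A A :|: tris A (~: A) (~: A).
  apply/fintype.subsetP => -[a [b c]]; rewrite !inE /= => /and3P[-> -> /eqP ->].
  by case: (c \in A).
have := le_trans (card_sub_le R hD) (card_setU_le R _ _).
suff : \sum_(a in A) (#|homog a|%:R : R) <= #|D|%:R by lra.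
rewrite card_fibers natr_sum [X in _ <= X](bigID (mem A)) /=.
rewrite -[X in X <= _]addr0; apply: lerD; last exact: sumr_ge0.
apply: ler_sum => a aA; apply: card_sub_le; apply/fintype.subsetP => q hq.
by rewrite 2!inE /= aA.
Qed.

(** A typical [a] has a double neighbour on each side with which it has few common apexes on that
    side. One such edge inside [A] yields an [a] of low degree into [A]; a second, from [a] to some
    [b] outside [A], makes the two degrees sum to too little. *)
Lemma barrier : (#|V| <= 3 * #|A|)%N -> (#|V| <= 3 * #|~: A|)%N ->
  #|tris A A A|%:R < eps ^+ 3 / 128 * n ^+ 3 ->
  #|tris A (~: A) (~: A)|%:R < eps ^+ 3 / 128 * n ^+ 3 -> False.
Proof.
move=> cA cB h1 h2; have e0 := heps; have e1 := heps1; have nn := n0.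
have en : 0 < eps * n by rewrite mulr_gt0.
have enn : eps * n <= 1 / 10 * n by rewrite ler_pM2r.
have hs := sum_homog h1 h2.
pose good a := #|homog a|%:R < eps ^+ 2 / 16 * n ^+ 2.
pose bad := [set a in A | ~~ good a].
(* Markov's inequality applied to [sum_homog]. *)
have cbad : #|bad|%:R <= eps / 4 * n.
  have h3 : #|bad|%:R * (eps ^+ 2 / 16 * n ^+ 2) <= \sum_(a in A) (#|homog a|%:R : R).
    rewrite mulr_natl -sumr_const [X in _ <= X](bigID (mem bad)) /=.
    rewrite -[X in X <= _]addr0; apply: lerD; last exact: sumr_ge0.
    rewrite [X in _ <= X](eq_bigl (mem bad)); last first.
      by move=> a; rewrite !inE /=; case: (a \in A).
    by apply: ler_sum => a; rewrite inE -leNgt => /andP[].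
  have q0 : 0 < eps ^+ 2 / 16 * n ^+ 2 by rewrite mulr_gt0 ?divr_gt0 ?exprn_gt0.
  rewrite -(ler_pM2r q0); apply: (le_trans h3); apply: (le_trans (ltW hs)).
  by rewrite le_eqVlt; apply/orP; left; apply/eqP; field.
have hA : homogeneous A by move=> x y -> ->.
have hB : homogeneous (~: A) by move=> x y; rewrite !inE => /negbTE-> /negbTE->.
have many_nb a : good a -> 5 / 4 * (eps * n) <= #|NH M a :&: A|%:R /\
    5 / 4 * (eps * n) <= #|NH M a :&: ~: A|%:R.
  move=> ga; have := card_NH_in ga hA; have := card_NH_in ga hB.
  have := cardsID A (NH M a); move/(congr1 (fun k => k%:R : R)); rewrite natrD setDE.
  by have := card_NH hM hdeg a; lra.
(* After discarding [bad], [eps * n] candidates remain; if each had more than [eps / 16 * n] apexes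
   with [a] in [X], then [homog a] would be too large. *)
have nbr a (X : {set V}) : good a -> homogeneous X -> 5 / 4 * (eps * n) <= #|NH M a :&: X|%:R ->
    exists x, [/\ x \in X, x \notin bad &
      (deg_in X a)%:R + (deg_in X x)%:R <= 2 * #|X|%:R + eps / 8 * n].
  move=> ga hX hc; pose Q := (NH M a :&: X) :\: bad.
  have cQ : eps * n <= #|Q|%:R.
    have := cardsID bad (NH M a :&: X); move/(congr1 (fun k => k%:R : R)); rewrite natrD -/Q.
    by have := card_sub_le R (subsetIr (NH M a :&: X) bad); lra.
  have [x xQ hx] : exists2 x, x \in Q & #|apexes M (a, x) :&: X|%:R <= eps / 16 * n.
    apply: contrapT => hn.
    have hsub : (#|[set q : V * V | (q.1 \in Q) && (q.2 \in apexes M (a, q.1) :&: X)]|%:R : R)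
       <= #|homog a|%:R.
      apply: card_sub_le; apply/fintype.subsetP => -[b b']; rewrite !inE /=.
      move=> /andP[/and3P[_ _ bX] /andP[t b'X]].
      by rewrite (hX _ _ bX b'X) eqxx andbT -tri_rot.
    have h4 : #|Q|%:R * (eps / 16 * n) <=
        #|[set q : V * V | (q.1 \in Q) && (q.2 \in apexes M (a, q.1) :&: X)]|%:R.
      rewrite card_fibers natr_sum [X in _ <= X](bigID (mem Q)) /=.
      rewrite -[X in X <= _]addr0; apply: lerD; last exact: sumr_ge0.
      rewrite mulr_natl -sumr_const; apply: ler_sum => b bQ.
      apply: le_trans (_ : #|apexes M (a, b) :&: X|%:R <= _).
        by rewrite leNgt; apply/negP => /ltW hh; apply: hn; exists b.
      by apply: card_sub_le; apply/fintype.subsetP => z zS; rewrite 2!inE /= bQ.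
    have h5 : eps * n * (eps / 16 * n) <= #|Q|%:R * (eps / 16 * n).
      by rewrite ler_pM2r // mulr_gt0 // divr_gt0.
    move: ga; rewrite /good.
    have -> : eps ^+ 2 / 16 * n ^+ 2 = eps * n * (eps / 16 * n) by ring.
    lra.
  move: (xQ); rewrite inE in_setI => /and3P[xb xN xX]; exists x; split => //.
  have hh : hedge M (a, x) by rewrite inE in xN.
  have := hedge_degree_in hM X hh; rewrite -(ler_nat R) natrD [X in _ <= X]natrD !natrM /= -!/(deg_in _ _).
  lra.
have cAR : n <= 3 * #|A|%:R by rewrite -natrM ler_nat.
have cBR : n <= 3 * #|~: A|%:R by rewrite -natrM ler_nat.
have [a [aA ga da]] : exists a, [/\ a \in A, good a & (deg_in A a)%:R <= #|A|%:R + eps / 16 * n].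
  have [a0 a0A] : exists2 a0, a0 \in A & good a0.
    apply: contrapT => hn; have hs' : A \subset bad.
      apply/fintype.subsetP => a aA; rewrite inE aA; apply/negP => ga; apply: hn; by exists a.
    by have := card_sub_le R hs'; lra.
  move=> ga0; have [a1 [a1A a1b hd]] := nbr _ _ ga0 hA (many_nb _ ga0).1.
  have ga1 : good a1 by move: a1b; rewrite inE a1A negbK.
  have [h|h] := leP ((deg_in A a0)%:R : R) (#|A|%:R + eps / 16 * n); first by exists a0.
  by exists a1; split=> //; lra.
(* The degrees of [a] and [b] now sum to at most [3 * #|A| + 2 * #|~: A|] plus a small error, which
   forces the complement of [A] below a third. *)
have [b [bB _ hb]] := nbr _ _ ga hB (many_nb _ ga).2.
have := deg_in_le A b; rewrite -(ler_nat R) natrM.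
have := hdeg a; have := hdeg b; rewrite !(degree_split A) !natrD.
have := cardsC A; move/(congr1 (fun k => k%:R : R)); rewrite natrD.
lra.
Qed.

End Barrier.

Variable alpha : R.
Hypothesis halpha : 0 < alpha.
Hypothesis hsplit : ~ splittable alpha (double_graph M).
Hypothesis hdvd : (3 %| #|V|)%N.

(** The minimum is a density of 5-triangles: the first term is the threshold of [barrier], the
    second is half of the density of those crossing the partition. The factor 4 is the loss in
    [reach_merge]. *)
Definition reach_const : R := Num.min (eps ^+ 3 / 128) (alpha / 6) / 4.

Lemma reach_all x y : reach M reach_const 38 x y.
Proof.
have e0 := heps; have e1 := heps1; have nn := n0; have a0 := halpha.
set g := Num.min (eps ^+ 3 / 128) (alpha / 6).
have g1 : g <= eps ^+ 3 / 128 by rewrite /g ge_min lexx.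
have g2 : g <= alpha / 6 by rewrite /g ge_min lexx orbT.
have g0 : 0 < g by rewrite /g lt_min !divr_gt0 // exprn_gt0.
have rcE : reach_const = g / 4 by [].
have e2 : eps ^+ 2 <= eps / 10 by rewrite expr2 ler_pM2l //; lra.
have e2' : 0 < eps ^+ 2 by rewrite exprn_gt0.
have e3 : eps ^+ 3 <= eps ^+ 2 / 10 by rewrite exprSr ler_pM2l //; lra.
have rc6 : reach_const <= eps / 6 by rewrite rcE; lra.
have [h|[A [cA cB rA rB]]] := reach_dichotomy hM heps heps1 V0 hdeg hdvd.
  by apply: (@reach_pad _ 5 11) => //; apply: reach_le (h x y); rewrite rcE; lra.
set B := ~: A in cB rB.
have rc12 : reach_const <= eps ^+ 2 / 12 by rewrite rcE; lra.
have {}rA : {in A &, forall x y, reach M reach_const 8 x y}.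
  by move=> u v uA vA; apply: reach_le (rA _ _ uA vA).
have {}rB : {in B &, forall x y, reach M reach_const 8 x y}.
  by move=> u v uA vA; apply: reach_le (rB _ _ uA vA).
suff cross z z' : z \in A -> z' \in B -> reach M reach_const 38 z z'.
  have [xA|xA] := boolP (x \in A); have [yA|yA] := boolP (y \in A).
  - by apply: (@reach_pad _ 8 10) => //; apply: rA.
  - by apply: cross => //; rewrite inE.
  - by apply: reach_sym; apply: cross => //; rewrite inE.
  - by apply: (@reach_pad _ 8 10) => //; apply: rB; rewrite inE.
move=> zA zB.
have hE : alpha * n ^+ 2 < (edges_between (double_graph M) A B)%:R.
  rewrite ltNge; apply/negP => hE; apply: hsplit; exists A, B; split => //.
  - by rewrite setUCr.
  - by rewrite -setI_eq0 setICr.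
  - by have : n <= 3 * #|A|%:R; [rewrite -natrM ler_nat | lra].
  - by have : n <= 3 * #|B|%:R; [rewrite -natrM ler_nat | lra].
(* Each of the more than [alpha * n ^+ 2] crossing double edges has at least [n / 3] apexes. *)
have hT : alpha / 3 * n ^+ 3 <= #|tris A B A|%:R + #|tris A B B|%:R.
  set E := [set p in setX A B | adj (double_graph M) p.1 p.2].
  have Eh p : p \in E -> hedge M p by rewrite inE => /andP[].
  pose D := [set q : (V * V) * V | (q.1 \in E) && (q.2 \in apexes M q.1)].
  have h1 : #|E|%:R * (n / 3) <= #|D|%:R.
    rewrite (card_fibers D) natr_sum [X in _ <= X](bigID (mem E)) /=.
    rewrite -[X in X <= _]addr0; apply: lerD; last exact: sumr_ge0.
    rewrite mulr_natl -sumr_const; apply: ler_sum => p pE.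
    apply: le_trans (_ : #|apexes M p|%:R <= _).
      apply: le_trans (card_apexes hM hdeg (Eh _ pE)).
      by have : 0 < eps * n; [rewrite mulr_gt0 | lra].
    by apply: card_sub_le; apply/fintype.subsetP => t tp; rewrite 2!inE /= pE.
  have h2 : (#|D| <= #|tris A B A :|: tris A B B|)%N.
    rewrite -(card_imset _ (f := fun q : (V * V) * V => (q.1.1, (q.1.2, q.2)))); last first.
      by move=> [[a b] c] [[a' b'] c'] [] -> -> ->.
    apply: subset_leq_card; apply/fintype.subsetP => q /imsetP[[[a b] c]].
    rewrite inE /= => /andP[]; rewrite inE in_setX /= => /andP[/andP[h1' h2'] _].
    rewrite inE /= => t ->; rewrite !inE /= h1' -tri_rot t.
    by move: h2'; rewrite inE => ->; case: (c \in A).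
  have := card_setU_le R (tris A B A) (tris A B B); move: h2; rewrite -(ler_nat R).
  have : alpha * n ^+ 2 * (n / 3) <= #|E|%:R * (n / 3).
    by rewrite ler_pM2r ?divr_gt0 //; apply: ltW; apply: hE.
  have -> : alpha * n ^+ 2 * (n / 3) = alpha / 3 * n ^+ 3 by field.
  lra.
have n3 : 0 < n ^+ 3 by rewrite exprn_gt0.
have hg1 : g * n ^+ 3 <= eps ^+ 3 / 128 * n ^+ 3 by rewrite ler_pM2r.
have hg2 : g * n ^+ 3 <= alpha / 6 * n ^+ 3 by rewrite ler_pM2r.
have mg X Y := reach_merge (X := X) (Y := Y) (A := A) (B := B) V0 (ltW g0) rcE.
have cA' : (#|V| <= 3 * #|~: B|)%N by rewrite setCK.
(* If both crossing types are frequent, they merge the classes directly. If only one is, it merges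
   them together with the type inside its majority class, or else [barrier] applies to that
   class. *)
have [hA|hA] := leP (g * n ^+ 3) #|tris A B A|%:R; have [hB|hB] := leP (g * n ^+ 3) #|tris A B B|%:R.
- by apply: (mg A B).
- have [h|h] := leP (g * n ^+ 3) #|tris A A A|%:R.
    by apply: (mg A A) => //; rewrite card_tris_swap.
  by exfalso; apply: (@barrier A) => //; apply: lt_le_trans hg1.
- have [h|h] := leP (g * n ^+ 3) #|tris B B B|%:R.
    by apply: (mg B B) => //; rewrite -card_tris_rot.
  exfalso; apply: (@barrier B) => //; first exact: lt_le_trans hg1.
  rewrite setCK card_tris_rot card_tris_rot; exact: lt_le_trans hg1.
- by move: hT; lra.
Qed.

End Merge.

(** * Absorbing families *)

Section Absorb.
Variables (R : realType) (V : finType) (M : multigraph V).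
Notation tileable := (tileable M).
Notation n := (#|V|%:R : R).

Definition list3 (t : V * V * V) := [:: t.1.1; t.1.2; t.2].

Definition absorbs s t := tileable s /\ tileable (list3 t ++ s).

(** The absorber is a tile [u v w] followed by connectors for [x u], [y v] and [z w]: alone, the
    connectors take [u], [v], [w]; with the triple present, they take [x], [y], [z] and [u v w] is a
    tile. *)
Lemma many_absorbs (c : R) k :
  (forall P : seq V -> Prop, (forall x y z, tri M x y z -> P [:: x; y; z]) -> many c 3 P) ->
  (forall x y, reach M c k x y) ->
  forall t, many c (3 + (k + (k + k))) (fun s => absorbs s t).
Proof.
move=> hT hR [[x y] z].
pose P (s : seq V) := exists u v w, s = [:: u; v; w] /\ tri M u v w.
have mP : many c 3 P by apply: hT => u v w t; exists u, v, w.
apply: (many_cat _ mP) => _ [u [v [w [-> t]]]].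
apply: (@many_cat _ _ c k (k + k) (fun s => tileable (x :: s) /\ tileable (u :: s)) _ _ (hR _ _)).
move=> s1 [a1 b1].
apply: (@many_cat _ _ c k k (fun s => tileable (y :: s) /\ tileable (v :: s)) _ _ (hR _ _)).
move=> s2 [a2 b2].
apply: (@many_mono _ _ c c k (fun s => tileable (z :: s) /\ tileable (w :: s)) _ (lexx c) _ (hR _ _)).
move=> s3 [a3 b3]; split.
  apply: (@tileable_perm _ _ ((u :: s1) ++ (v :: s2) ++ (w :: s3))); first by perm_tac.
  by do 2![apply: tileable_cat => //].
apply: (@tileable_perm _ _ ((x :: s1) ++ (y :: s2) ++ (z :: s3) ++ [:: u; v; w])).
  by rewrite /list3; perm_tac.
by do 3![apply: tileable_cat => //]; apply: tileable_tri.
Qed.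

Section Family.
Variables (c : R) (k : nat).
Hypothesis (c0 : 0 < c) (c1 : c <= 1) (V0 : (0 < #|V|)%N).
Hypothesis habs : forall t, many c k (fun s => absorbs s t).

Let ga := (c / 2) ^+ k.

Lemma ga_gt0 : 0 < ga. Proof. by rewrite exprn_gt0 // divr_gt0. Qed.

Lemma ga_le1 : ga <= 1.
Proof. by apply: exprn_ile1; have := c0; have := c1; lra. Qed.

(* Each new absorber is chosen to serve a positive proportion of the triples not yet served. *)
Lemma greedy_absorbers m (W : seq V) : uniq W -> (size W + m * k)%:R <= c / 2 * n ->
  exists (f : seq V) (Om : {set V * V * V}),
    [/\ uniq (f ++ W), (size f <= m * k)%N, tileable f,
        forall t, t \notin Om -> tileable (list3 t ++ f) &
        #|Om|%:R <= (1 - ga) ^+ m * n ^+ 3].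
Proof.
move=> uW; elim: m => [|m IH] hW.
  exists [::], setT; split=> //; first exact: tileable_nil.
    by move=> t; rewrite inE.
  by rewrite expr0 mul1r cardsT !card_prod !natrM -expr2 -exprSr.
have [|f [Om [uf sf tf hf cf]]] := IH.
  by apply: le_trans hW; rewrite ler_nat leq_add2l leq_mul2r leqnSn orbT.
have [Om0|Om0] := eqVneq Om set0.
  exists f, set0; split => //; first by rewrite (leq_trans sf) // leq_mul2r leqnSn orbT.
    by move=> t _; apply: hf; rewrite Om0 inE.
  by rewrite cards0 mulr_ge0 ?exprn_ge0 // subr_ge0 ga_le1.
have hWf : (size (f ++ W) + k)%:R <= c / 2 * n.
  by apply: le_trans hW; rewrite ler_nat size_cat mulSn; move: sf; move: (m * k)%N => mk; lia.
have c20 : 0 <= c / 2 by rewrite divr_ge0 // ltW.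
have [|s ss hs] := @many_pick R V _ (c / 2) k
   (fun t s => absorbs s t /\ uniq (s ++ (f ++ W))) Om V0 c20.
  by move=> t _; apply: many_fresh.
set S := [set t in Om | _] in hs.
have cOm : 0 < (#|Om|%:R : R) by rewrite ltr0n card_gt0.
have S0 : 0 < (#|S|%:R : R) by apply: lt_le_trans hs; rewrite mulr_gt0 // ga_gt0.
(* That [s] is tileable and fresh does not depend on the triple, so any served [t0] certifies it. *)
move: S0; rewrite ltr0n => /card_gt0P[t0]; rewrite inE => /andP[_ /asboolP[[ts _] us]].
exists (s ++ f), (Om :\: S); split.
- by rewrite -catA.
- by rewrite size_cat ss mulSn leq_add2l.
- exact: tileable_cat.
- move=> t; rewrite !inE negb_and negbK => /orP[/andP[_ /asboolP[[_ h] _]]|tO].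
    by rewrite catA; apply: tileable_cat.
  apply: (@tileable_perm _ _ ((list3 t ++ f) ++ s)); last by apply: tileable_cat => //; apply: hf.
  by perm_tac.
have := cardsID S Om; have -> : Om :&: S = S.
  by apply/setIidPr/fintype.subsetP => t; rewrite inE => /andP[].
move/(congr1 (fun k => k%:R : R)); rewrite natrD => hc.
rewrite exprS -mulrA; apply: le_trans (_ : (1 - ga) * #|Om|%:R <= _).
  by move: hs; rewrite -/ga; lra.
by rewrite ler_wpM2l // subr_ge0 ga_le1.
Qed.

Definition universal f := tileable f /\ forall t, tileable (list3 t ++ f).

(** After [m] greedy steps fewer than one triple is unserved, hence none; each further family avoids
    the earlier ones. *)
Lemma universal_family m t : (1 - ga) ^+ m * n ^+ 3 < 1 ->
  (t * (m * k))%:R <= c / 2 * n ->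
  exists fs : seq (seq V), [/\ size fs = t, uniq (flatten fs),
    (size (flatten fs) <= t * (m * k))%N & forall f, f \in fs -> universal f].
Proof.
move=> hm; elim: t => [|t IH] ht; first by exists [::].
have [|fs [sfs ufs cfs hfs]] := IH; first by apply: le_trans ht; rewrite ler_nat leq_mul2r leqnSn orbT.
have hW : (size (flatten fs) + m * k)%:R <= c / 2 * n.
  by apply: le_trans ht; rewrite ler_nat mulSn addnC leq_add2l.
have [f [Om [uf sf tf hf cf]]] := greedy_absorbers ufs hW.
have Om0 : Om = set0.
  by apply/eqP; rewrite -cards_eq0 -leqn0 -ltnS -(ltr_nat R); apply: le_lt_trans cf hm.
exists (f :: fs); split=> /=; first by rewrite sfs.
- by [].
- by rewrite size_cat mulSn leq_add.
move=> g; rewrite inE => /orP[/eqP ->|]; last exact: hfs.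
by split=> // t'; apply: hf; rewrite Om0 inE.
Qed.

End Family.

(** Each family absorbs one triple of [L], and surplus families tile themselves. *)
Lemma absorb_left (fs : seq (seq V)) (L : seq V) : (forall f, f \in fs -> universal f) ->
  (3 %| size L)%N -> (size L <= 3 * size fs)%N -> tileable (L ++ flatten fs).
Proof.
elim: fs L => [|f fs IH] L hfs dL sL.
  have -> : L = [::] by apply/size0nil; move: sL; rewrite /=; lia.
  exact: tileable_nil.
have [tf uf] := hfs f (mem_head _ _).
have hfs' g : g \in fs -> universal g by move=> gf; apply: hfs; rewrite inE gf orbT.
case: L dL sL => [|x [|y [|z L]]] //= dL sL.
  by apply: tileable_cat => //; apply: (IH [::]).
apply: (@tileable_perm _ _ ((list3 (x, y, z) ++ f) ++ (L ++ flatten fs))).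
  by rewrite /list3; perm_tac.
apply: tileable_cat; first exact: uf.
by apply: IH => //; lia.
Qed.

End Absorb.

(** The exponent contains four copies of [q], of order [m / (4 * D)]. Each gives a factor of order
    [1 / m] by the Bernoulli-type bound [b2], and the fourth power beats the cube once [m] exceeds
    [e ^+ 4]. *)
Lemma exp_beats_cube (R : realType) (g : R) (D : nat) : 0 < g -> g <= 1 -> (0 < D)%N ->
  exists n0 : nat, forall m : nat, (n0 <= m)%N -> (1 - g) ^+ (m %/ D) * m%:R ^+ 3 < 1.
Proof.
move=> g0 g1 D0.
have D0' : 0 < (D%:R : R) by rewrite ltr0n.
set e := 8 * D%:R / g.
have e0 : 0 < e by rewrite divr_gt0 // mulr_gt0.
have [N hN] : exists N : nat, e ^+ 4 < N%:R.
  by exists (Num.bound (e ^+ 4)); apply: archi_boundP; rewrite exprn_ge0 // ltW.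
exists (maxn N (8 * D)) => m; rewrite geq_max => /andP[hm1 hm2].
set q := (m %/ (4 * D))%N.
have hq : m%:R <= 8 * D%:R * (q%:R : R).
  rewrite -!natrM ler_nat; have := divn_eq m (4 * D); rewrite -/q.
  have : (m %% (4 * D) < 4 * D)%N by rewrite ltn_mod; lia.
  by nia.
have hq2 : (4 * q <= m %/ D)%N.
  rewrite leq_divRL // /q.
  by have := leq_trunc_div m (4 * D); nia.
have g10 : 0 <= 1 - g by lra.
have b1 : (1 - g) ^+ (m %/ D) <= (1 - g) ^+ (4 * q).
  by apply: ler_wiXn2l => //; lra.
have b2 p : (1 - g) ^+ p * (1 + p%:R * g) <= 1.
  elim: p => [|p IH]; first by rewrite expr0 mul0r addr0 mul1r.
  rewrite exprSr -mulrA; apply: le_trans IH.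
  rewrite ler_wpM2l ?exprn_ge0 // -natr1.
  have gg : 0 <= g * g by apply: mulr_ge0; apply: ltW.
  have : 0 <= p%:R * (g * g) by rewrite mulr_ge0.
  lra.
have m0 : 0 < (m%:R : R) by rewrite ltr0n; lia.
have q0 : 0 < (q%:R : R) by rewrite -(pmulr_rgt0 _ (mulr_gt0 (ltr0Sn R 7) D0')); exact: lt_le_trans hq.
have b3 : (1 - g) ^+ q * (m%:R / e) <= 1.
  apply: le_trans (b2 q); rewrite ler_wpM2l ?exprn_ge0 //.
  rewrite ler_pdivrMr // /e; apply: (le_trans hq).
  have -> : (1 + q%:R * g) * (8 * D%:R / g) = 8 * D%:R / g + 8 * D%:R * q%:R.
    by field; rewrite gt_eqF.
  by rewrite lerDr divr_ge0 ?ltW // mulr_gt0.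
have b4 : (1 - g) ^+ (4 * q) * (m%:R / e) ^+ 4 <= 1.
  rewrite mulnC exprM -exprMn; apply: exprn_ile1 => //.
  by apply: mulr_ge0; [apply: exprn_ge0 | apply: divr_ge0; apply: ltW].
have me : e ^+ 4 < m%:R by apply: (lt_le_trans hN); rewrite ler_nat.
have b5 : (1 - g) ^+ (4 * q) * m%:R ^+ 4 <= e ^+ 4.
  by move: b4; rewrite expr_div_n mulrA ler_pdivrMr ?exprn_gt0 // mul1r.
rewrite -(ltr_pM2r m0) mul1r -mulrA -exprSr.
apply: le_lt_trans me; apply: le_trans b5.
by rewrite ler_wpM2r // exprn_ge0 // ltW.
Qed.

(** * The factor *)

Lemma tileable_enum (R : realType) (eps alpha : R) : 0 < eps -> eps <= 1 / 10 -> 0 < alpha ->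
  exists n0 : nat, forall (V : finType) (M : multigraph V),
    standard M -> (n0 <= #|V|)%N -> (3 %| #|V|)%N ->
    (forall x, (4 / 3 + eps) * #|V|%:R <= (degree M x)%:R) ->
    ~ splittable alpha (double_graph M) ->
    tileable M (enum V).
Proof.
move=> e0 e1 a0; set c := reach_const eps alpha.
have [c0 c6] : 0 < c /\ c <= eps / 6.
  have e2 : eps ^+ 2 <= eps / 10 by rewrite expr2 ler_pM2l //; lra.
  have e3 : eps ^+ 3 <= eps / 10 * eps by rewrite exprSr ler_pM2r.
  have e4 : eps * eps <= eps / 10 by rewrite -expr2.
  have hmin : Num.min (eps ^+ 3 / 128) (alpha / 6) <= eps ^+ 3 / 128 by rewrite ge_min lexx.
  have h1 : c * 4 <= eps ^+ 3 / 128 by rewrite /c /reach_const; lra.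
  have h2 : 0 < c by rewrite /c /reach_const divr_gt0 // lt_min !divr_gt0 // exprn_gt0.
  by split=> //; lra.
pose k := (3 + (38 + (38 + 38)))%N.
(* [near_tiling] is applied with [eps / 2], so it leaves at most [12 / eps] vertices. *)
have [t ht] : exists t : nat, 12 / eps < t%:R.
  by exists (Num.bound (12 / eps)); apply: archi_boundP; rewrite divr_ge0 // ltW.
(* The absorbers must leave enough fresh choices ([c / 2]) and keep the degree condition with
   [eps / 2] on the remaining vertices ([eps / 8]). *)
pose ka := Num.min (c / 2) (eps / 8).
have ka0 : 0 < ka by rewrite /ka lt_min; apply/andP; split; lra.
have [D hD] : exists D : nat, (t * k)%:R / ka < D%:R.
  by exists (Num.bound ((t * k)%:R / ka)); apply: archi_boundP; rewrite divr_ge0 // ltW.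
have D0 : (0 < D)%N.
  by rewrite -(ltr0n R); apply: le_lt_trans hD; rewrite divr_ge0 // ltW.
have c1 : c <= 1 by lra.
have [n1 hn1] := exp_beats_cube (ga_gt0 k c0) (ga_le1 k c0 c1) D0.
have [n2 hn2] : exists n2 : nat, 128 / eps ^+ 2 < n2%:R.
  by exists (Num.bound (128 / eps ^+ 2)); apply: archi_boundP; rewrite divr_ge0 // exprn_ge0 // ltW.
exists (maxn 1 (maxn n1 n2)) => V M hM; rewrite !geq_max => /and3P[V0 nn1 nn2] d3 hdeg hsp.
have hR := reach_all hM e0 e1 V0 hdeg a0 hsp d3.
have hT (P : seq V -> Prop) : (forall x y z, tri M x y z -> P [:: x; y; z]) -> many c 3 P.
  by move=> hP; apply: (many_tri hM e0 e1 V0 hdeg c6 hP).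
have habs := many_absorbs hT hR.
set n := (#|V|%:R : R) in hdeg *.
have n0 : 0 < n by rewrite ltr0n.
have hka : (t * (#|V| %/ D * k))%:R <= ka * n.
  have h1 : (t * k)%:R <= ka * D%:R by rewrite mulrC -ler_pdivrMr // ltW.
  have h2 : ((#|V| %/ D)%:R : R) * D%:R <= n by rewrite -natrM ler_nat leq_trunc_div.
  have -> : (t * (#|V| %/ D * k) = (#|V| %/ D) * (t * k))%N by rewrite mulnCA.
  rewrite natrM; apply: le_trans (_ : (#|V| %/ D)%:R * (ka * D%:R) <= _).
    by rewrite ler_wpM2l.
  by rewrite mulrCA ler_pM2l.
have kac : ka <= c / 2 by rewrite /ka ge_min lexx.
have kae : ka <= eps / 8 by rewrite /ka ge_min lexx orbT.
have [|fs [sfs ufs cfs hfs]] := universal_family c0 c1 V0 habs (hn1 _ nn1) (t := t).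
  by apply: (le_trans hka); rewrite ler_pM2r.
set F := flatten fs in ufs cfs.
have cF : (size F)%:R <= eps / 8 * n.
  apply: le_trans (_ : ka * n <= _); last by rewrite ler_pM2r.
  by apply: le_trans hka; rewrite ler_nat.
pose u := [seq v <- enum V | v \notin F].
have pFu : perm_eq (F ++ u) (enum V).
  apply: uniq_perm; rewrite ?enum_uniq //.
    rewrite cat_uniq ufs filter_uniq ?enum_uniq // andbT /=.
    by apply/hasPn => v; rewrite mem_filter => /andP[].
  by move=> v; rewrite mem_cat mem_filter mem_enum andbT orbN.
have sFu : (size F + size u = #|V|)%N by rewrite -size_cat (perm_size pFu) -cardE.
have sFuR : (size F)%:R + (size u)%:R = n by rewrite -natrD sFu.
have F0 : 0 <= ((size F)%:R : R) by rewrite ler0n.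
have hdegu x : x \in u -> (4 / 3 + eps / 2) * (size u)%:R <= (\sum_(y <- u) mult M x y)%N%:R.
  move=> _; have hF : (\sum_(y <- F) mult M x y <= 2 * size F)%N.
    by rewrite mulnC; apply: sum_le_const => y _; apply: hM.
  have := hdeg x; have -> : degree M x = (\sum_(y <- F) mult M x y + \sum_(y <- u) mult M x y)%N.
    by rewrite -big_cat /= (perm_big _ pFu) /= big_enum.
  rewrite natrD; move: hF; rewrite -(ler_nat R) natrM.
  have en : 0 < eps * n by rewrite mulr_gt0.
  have eF : 0 <= eps * (size F)%:R by rewrite mulr_ge0 // ltW.
  have -> : (size u)%:R = n - (size F)%:R by lra.
  lra.
have hnu : 16 <= (eps / 2) ^+ 2 * (size u)%:R.
  have h1 : 128 <= n * eps ^+ 2.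
    by rewrite -ler_pdivrMr ?exprn_gt0 //; apply: (le_trans (ltW hn2)); rewrite ler_nat.
  have h2 : n / 2 <= (size u)%:R.
    have : eps * n <= 1 / 10 * n by rewrite ler_pM2r.
    lra.
  have h3 : eps ^+ 2 * (n / 2) <= eps ^+ 2 * (size u)%:R by rewrite ler_pM2l // exprn_gt0.
  lra.
have e20 : 0 < eps / 2 by rewrite divr_gt0.
have [ts [L [hts pL cL]]] := near_tiling hM e20 hdegu hnu.
have sL : (size L <= 3 * t)%N.
  rewrite -(ler_nat R) natrM; move: ht; rewrite ltr_pdivrMr // => ht.
  have : (size L)%:R * eps <= 3 * t%:R * eps by have : 0 <= t%:R * eps; [rewrite mulr_ge0 // ltW | lra].
  by rewrite ler_pM2r.
have tF : tileable M F.
  have := @absorb_left V M fs [::] hfs; apply => //.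
have dL : (3 %| size L)%N.
  have du : (3 %| size u)%N by move: d3; rewrite -sFu dvdn_addr // (tileable_size tF).
  by move: du; rewrite -(perm_size pL) size_cat size_flat3 dvdn_addr // dvdn_mulr.
have tLF : tileable M (L ++ F) by apply: absorb_left; rewrite ?sfs.
apply: (@tileable_perm _ _ (flat3 ts ++ (L ++ F))); last by apply: tileable_cat => //; exists ts.
by apply: perm_trans pFu; rewrite catA perm_catC; apply: perm_cat.
Qed.

(** * Realizing tiles as sub-multigraphs *)

Section Factor.
Variables (V : finType) (M : multigraph V).
Hypothesis hM : standard M.
Notation mu := (mult M).

Lemma sum_set3 (x y z : V) (F : V -> nat) : uniq [:: x; y; z] ->
  (\sum_(v : {v | v \in [set x; y; z]}) F (val v) = F x + F y + F z)%N.
Proof.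
move=> u3; have hp : perm_eq [seq val v | v : {v | v \in [set x; y; z]}] [:: x; y; z].
  apply: uniq_perm => //; first by rewrite map_inj_uniq ?enum_uniq //; apply: val_inj.
  move=> w; apply/mapP/idP => [[v _ ->]|].
    by have := valP v; rewrite !inE orbA.
  rewrite !inE orbA => hw; have hw' : w \in [set x; y; z] by rewrite !inE.
  by exists (exist _ w hw') => //; rewrite mem_enum.
have -> : (\sum_(v : {v | v \in [set x; y; z]}) F (val v) =
    \sum_(w <- [seq val v | v : {v | v \in [set x; y; z]}]) F w)%N.
  by rewrite big_map big_enum.
by rewrite (perm_big _ hp) unlock /= addn0 addnA.
Qed.

Section Tile.
Variables x y z : V.

(** [y] is the common end of the two double edges; the pair [x z] gets multiplicity 1 even if it is
    double in [M], so that the total is exactly 5. *)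
Definition tile_mult (u v : V) : nat :=
  if u == v then 0 else if (u == y) || (v == y) then 2 else 1.

Fact tile_sym (u v : {v | v \in [set x; y; z]}) :
  tile_mult (val u) (val v) = tile_mult (val v) (val u).
Proof. by rewrite /tile_mult eq_sym orbC. Qed.

Fact tile_loopless (u : {v | v \in [set x; y; z]}) : tile_mult (val u) (val u) = 0%N.
Proof. by rewrite /tile_mult eqxx. Qed.

Hypothesis (hxy : mu x y = 2) (hyz : mu y z = 2) (hxz : (0 < mu x z)%N).

Fact tile_le (u v : {v | v \in [set x; y; z]}) :
  (tile_mult (val u) (val v) <= mu (val u) (val v))%N.
Proof.
case: u v => [u hu] [v hv] /=; move: hu hv; rewrite !inE -!orbA /tile_mult.
have hyx : mu y x = 2 by rewrite mult_sym.
have hzy : mu z y = 2 by rewrite mult_sym.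
have hzx : (0 < mu z x)%N by rewrite mult_sym.
have xy : (x == y) = false by apply/eqP => e; move: hxy; rewrite e mult_loopless.
have zy : (z == y) = false by apply/eqP => e; move: hzy; rewrite e mult_loopless.
have yx : (y == x) = false by rewrite eq_sym.
have yz : (y == z) = false by rewrite eq_sym.
case/or3P=> /eqP-> /or3P[] /eqP->; rewrite ?eqxx ?xy ?yx ?zy ?yz //= ?hxy ?hyz ?hyx ?hzy //.
  by case: ifP.
by case: ifP.
Qed.

Definition tile : sub_multigraph M :=
  @SubMultigraph V M [set x; y; z] (Multigraph tile_sym tile_loopless) tile_le.

Lemma tile_five : five_triangle tile.
Proof.
have xy : x != y by apply: contra_eq_neq hxy => ->; rewrite mult_loopless.
have yz : y != z by apply: contra_eq_neq hyz => ->; rewrite mult_loopless.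
have xz : x != z by apply: contraTneq hxz => ->; rewrite mult_loopless.
have u3 : uniq [:: x; y; z] by rewrite /= !inE negb_or xy xz yz.
apply/and3P; split.
- by rewrite card_sig (eq_card (B := [set x; y; z])) // -setUA !cardsU1 cards1 !inE negb_or xy xz yz.
- apply/forallP => u; apply/forallP => v; apply/implyP => uv /=.
  by rewrite /tile_mult (negbTE (_ : val u != val v)) //; case: ifP.
rewrite /num_edges /degree /=.
under eq_bigr => u _ do rewrite (sum_set3 (fun v => tile_mult (val u) v) u3).
rewrite (sum_set3 (fun u => tile_mult u x + tile_mult u y + tile_mult u z)%N u3) /tile_mult.
by rewrite !eqxx (negbTE xy) (negbTE yz) (negbTE xz) ![_ == x]eq_sym ![z == _]eq_sym
   (negbTE xy) (negbTE yz) (negbTE xz).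
Qed.

End Tile.

Lemma tri_tile x y z : tri M x y z ->
  exists2 T : sub_multigraph M, five_triangle T & sub_verts T = [set x; y; z].
Proof.
move=> t; have : [|| (mu x y == 2) && (mu y z == 2), (mu y z == 2) && (mu z x == 2) |
    (mu z x == 2) && (mu x y == 2)].
  by move: t (hM x y) (hM y z) (hM x z); rewrite /tri (mult_sym M z x); lia.
have [h1 h2 h3] : [/\ (0 < mu x z)%N, (0 < mu y x)%N & (0 < mu z y)%N].
  by move: t; rewrite /tri (mult_sym M y x) (mult_sym M z y) => /and4P[].
case/or3P => /andP[/eqP a /eqP b].
- by exists (tile a b h1); first exact: tile_five.
- exists (tile a b h2); first exact: tile_five.
  by apply/setP => v; rewrite !inE; case: (v == x); case: (v == y); case: (v == z).
- exists (tile a b h3); first exact: tile_five.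
  by apply/setP => v; rewrite !inE; case: (v == x); case: (v == y); case: (v == z).
Qed.

(** The inclusion of each member in the covered set strengthens the induction: it gives disjointness
    from the next tile. *)
Lemma factor_of_tris (ts : seq (V * V * V)) : all (tri3 M) ts -> uniq (flat3 ts) ->
  exists F : seq (sub_multigraph M),
    [/\ all (fun T : sub_multigraph M => five_triangle T) F,
      pairwise (fun T1 T2 => [disjoint sub_verts T1 & sub_verts T2]) F,
      all (fun T => sub_verts T \subset [set v in flat3 ts]) F &
      \bigcup_(T <- F) sub_verts T = [set v in flat3 ts]].
Proof.
elim: ts => [|[[x y] z] ts IH] /=.
  by exists [::]; split=> //; rewrite big_nil; apply/setP => v; rewrite !inE.
move=> /andP[t hts] u; have [T T5 TS] := tri_tile t.
have {}u : uniq ([:: x; y; z] ++ flat3 ts) by [].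
move: u; rewrite cat_uniq => /and3P[_ /hasPn u1 u2].
have [F [F5 Fd Fs FU]] := IH hts u2.
exists (T :: F); split=> /=; first by rewrite T5.
- rewrite Fd andbT; apply: sub_all Fs => T' sT'.
  rewrite disjoint_sym TS; apply: (disjointWl sT').
  rewrite disjoint_subset; apply/fintype.subsetP => v; rewrite !inE => vts.
  by have := u1 v vts; rewrite !inE -!orbA.
- rewrite TS; apply/andP; split.
    by apply/fintype.subsetP => v; rewrite !inE -!orbA => /or3P[] ->; rewrite ?orbT.
  apply: sub_all Fs => T' sT'; apply: (subset_trans sT').
  by apply/fintype.subsetP => v; rewrite !inE => ->; rewrite !orbT.
by rewrite big_cons FU TS; apply/setP => v; rewrite !inE -!orbA.
Qed.

Lemma tileable_factor : tileable M (enum V) -> has_five_triangle_factor M.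
Proof.
move=> [ts hts hp]; have [|F [F5 Fd _ FU]] := factor_of_tris hts.
  by rewrite (perm_uniq hp) enum_uniq.
exists F; split => //; rewrite FU; apply/setP => v.
by rewrite !inE (perm_mem hp) mem_enum.
Qed.

End Factor.

Theorem theorem21 (R : realType) (eps alpha : R) (heps : 0 < eps) (halpha : 0 < alpha) :
  exists n0 : nat, forall (V : finType) (M : multigraph V),
    standard M ->
    (n0 <= #|V|)%N ->
    (3 %| #|V|)%N ->
    (4 / 3 + eps) * #|V|%:R <= (min_degree M)%:R ->
    ~ splittable alpha (double_graph M) ->
    has_five_triangle_factor M.
Proof.
(* Lowering [eps] only weakens the degree condition and allows its powers to be compared. *)
pose e := Num.min eps (1 / 10).
have e0 : 0 < e by rewrite lt_min heps; lra.
have e1 : e <= 1 / 10 by rewrite ge_min lexx orbT.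
have e2 : e <= eps by rewrite ge_min lexx.
have [n0 hn0] := tileable_enum e0 e1 halpha.
exists n0 => V M hM hn h3 hdeg hsplit; apply: tileable_factor => //.
apply: hn0 => // x; apply: le_trans (_ : (min_degree M)%:R <= _).
  by apply: le_trans hdeg; rewrite ler_wpM2r //; lra.
(* The default value for an empty vertex set cannot occur, as [x] is a vertex. *)
rewrite ler_nat /min_degree; case: pickP => [x0 _|/(_ x)] //.
by case: arg_minnP => // y _; apply.
Qed.
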